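(* Let $u,v$ be positive integers, let $H$ be any graph, and let $S=K[V(K_{u,v}\odot H)]$. Then $$\operatorname{reg}(S/I(K_{u,v}\odot H))=\begin{cases}\max\{u,v\}, & \text{if } H \text{ is a null graph};\\ (u+v)\cdot\operatorname{reg}(K[V(H)]/I(H)), & \text{otherwise}.\end{cases}$$
   Context: $K$ is a field. All graphs are finite, simple, have nonempty vertex set, and may have isolated vertices. Vertices of a graph $G$ are identified with the variables of the standard graded polynomial ring $K[V(G)]$. A null graph is a graph with no edges. Edge ideal convention: $I(G)\subset K[V(G)]$ is the ideal generated by all products $x_ix_j$ with $\{x_i,x_j\}\in E(G)$ together with all variables $x_k$ with $x_k$ an isolated vertex of $G$. (Thus $K[V(H)]/I(H)\cong K[V(H')]/I(H')$, where $H'$ is the induced subgraph of $H$ on the non-isolated vertices.) The corona product $X\odot H$ is the graph obtained from one copy of $X$ and $|V(X)|$ disjoint copies of $H$, namely $H_1,\dots,H_{|V(X)|}$, by joining the $i$-th vertex of $X$ to every vertex of $H_i$. It has no isolated vertices, so $I(X\odot H)$ is the usual edge ideal. $K_{u,v}$ is the complete bipartite graph with partite sets of sizes $u$ and $v$. $\operatorname{reg}(A)=\max\{j-i:\beta_{i,j}(A)\neq0\}$ is the Castelnuovo–Mumford regularity, where $\beta_{i,j}(A)$ are the graded Betti numbers of the finitely generated graded module $A$ over the corresponding polynomial ring. *)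

(* Defs.v *)
(* MathComp with the multinomials library; classical choice (epsilon) comes
   from the standard library. *)
From Stdlib Require Import ClassicalEpsilon.
From HB Require Import structures.
From mathcomp Require Import all_boot all_order all_algebra.
From mathcomp Require Import mpoly.

Set Implicit Arguments.
Unset Strict Implicit.
Unset Printing Implicit Defensive.

Import GRing.Theory.
Local Open Scope ring_scope.

Record sgraph := SGraph {
  vertex :> finType;
  adj : rel vertex;
  adj_sym : ssrbool.symmetric adj;
  adj_irr : irreflexive adj
}.

Definition isolated (G : sgraph) (x : G) : bool := [forall y, ~~ adj x y].

Definition null_graph (G : sgraph) : bool :=
  [forall x : G, forall y : G, ~~ adj x y].

Section Bipartite.
Variables u v : nat.

Definition biclique_adj : rel ('I_u + 'I_v) := fun x y =>
  match x, y with
  | inl _, inr _ | inr _, inl _ => true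
  | _, _ => false
  end.

Lemma biclique_sym : ssrbool.symmetric biclique_adj.
Proof. by case=> ? []. Qed.

Lemma biclique_irr : irreflexive biclique_adj.
Proof. by case. Qed.

Definition biclique : sgraph := SGraph biclique_sym biclique_irr.

End Bipartite.

Section Corona.
Variables X H : sgraph.

(* inl x is the vertex x of X; inr (x, h) is the vertex h of the copy of H
   attached to x. *)
Definition corona_adj : rel (X + X * H) := fun a b =>
  match a, b with
  | inl x, inl y => adj x y
  | inl x, inr (y, _) => x == y
  | inr (x, _), inl y => x == y
  | inr (x, h), inr (y, k) => (x == y) && adj h k
  end.

Lemma corona_sym : ssrbool.symmetric corona_adj.
Proof.
move=> [x|[x h]] [y|[y k]] /=; rewrite ?[y == x]eq_sym //; first exact: adj_sym.
by rewrite adj_sym.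
Qed.

Lemma corona_irr : irreflexive corona_adj.
Proof. by case=> [x|[x h]] /=; rewrite adj_irr ?andbF. Qed.

Definition corona : sgraph := SGraph corona_sym corona_irr.

End Corona.

Section EdgeIdeal.
Variables (K : fieldType) (G : sgraph).

(* K[V(G)] is {mpoly K[#|G|]}, vertices being numbered by enum_rank. *)
Definition xvar (x : G) : {mpoly K[#|G|]} := 'X_(enum_rank x).

Definition edge_gens : seq {mpoly K[#|G|]} :=
  [seq xvar e.1 * xvar e.2 | e <- enum {: G * G} & adj e.1 e.2]
  ++ [seq xvar x | x <- enum G & isolated x].

Definition edge_ideal (f : {mpoly K[#|G|]}) : Prop :=
  exists c : 'I_(size edge_gens) -> {mpoly K[#|G|]},
    f = \sum_i c i * edge_gens`_i.

End EdgeIdeal.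

Section Regularity.
Variables (K : fieldType) (n : nat).
Local Notation S := {mpoly K[n]}.

(* p is homogeneous of degree a - b, hence zero if a < b *)
Definition homog_diff (a b : nat) (p : S) : bool :=
  if (b <= a)%N then p \is (a - b)%N.-homog else p == 0.

(* Minimal graded free resolutions
     ... -> F_2 -> F_1 -> F_0 -> S/I -> 0
   of S/I for a homogeneous ideal I. The free module F_i has a basis of rk i
   elements, the k-th one being of degree deg i k; elements of F_i are row
   vectors, on which matrices act on the right. The map F_(i+1) -> F_i is
   dif i, and F_0 -> S/I is aug followed by the projection S -> S/I. As S/I
   lives in nonnegative degrees, so do the generators of the F_i. *)
Record min_res (I : S -> Prop) := MinRes {
  rk : nat -> nat;
  deg : forall i, 'I_(rk i) -> nat;
  aug : 'M[S]_(rk 0, 1);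
  dif : forall i, 'M[S]_(rk i.+1, rk i);
  aug_homog : forall k, homog_diff (deg k) 0 (aug k 0);
  dif_homog : forall i k l, homog_diff (deg k) (deg l) (dif i k l);
  aug_surj : forall f, exists v : 'rV[S]_(rk 0), I (f - (v *m aug) 0 0);
  aug_exact : forall v : 'rV[S]_(rk 0),
    I ((v *m aug) 0 0) <-> exists w : 'rV[S]_(rk 1), v = w *m dif 0;
  dif_exact : forall i (v : 'rV[S]_(rk i.+1)),
    v *m dif i = 0 <-> exists w : 'rV[S]_(rk i.+2), v = w *m dif i.+1;
  (* minimality: dif i maps F_(i+1) into (x_1, ..., x_n) F_i *)
  dif_min : forall i k l, (dif i k l)@_0%MM = 0
}.

Definition res_betti (I : S -> Prop) (F : min_res I) (i j : nat) : nat :=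
  #|[set k : 'I_(rk F i) | deg k == j]|.

(* The graded Betti number beta_(i,j)(S/I); it does not depend on the minimal
   resolution used. *)
Definition betti (I : S -> Prop) (i j : nat) : nat :=
  epsilon (inhabits 0%N) (fun b => exists F : min_res I, b = res_betti F i j).

Definition is_reg (I : S -> Prop) (r : int) : Prop :=
  (exists i j, betti I i j <> 0%N /\ r = j%:Z - i%:Z) /\
  (forall i j, betti I i j <> 0%N -> j%:Z - i%:Z <= r).

(* reg(S/I), for a proper homogeneous ideal I *)
Definition reg (I : S -> Prop) : int := epsilon (inhabits 0) (is_reg I).

End Regularity.

(* Main.v *)
From Stdlib Require Import ClassicalEpsilon.
Require Import Defs.
From mathcomp Require Import all_boot all_order all_algebra.
From mathcomp Require Import mpoly ring zify.

Set Implicit Arguments.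
Unset Strict Implicit.
Unset Printing Implicit Defensive.

Import Order.TTheory GRing.Theory Num.Theory.
Local Open Scope ring_scope.

(** Why the formula holds.

    Combinatorial regularity. For a set [W] of vertices of a graph, consider the
    complex of independent subsets of [W]; [ind_nz W d] says that its reduced
    cohomology over [K] is nonzero in dimension [d - 1], so that [d] counts the
    vertices of the faces that carry the class. Hochster's formula describes
    the graded Betti numbers of [S/I(G)] by these groups, and [reg (S/I(G))] is
    the largest [d] such that [ind_nz W d] for some [W]; [ind_reg] is the
    predicate that says so of [d], and [reg_edge_ideal] is the equality.

    Coronas. A class on [W] gives, for every vertex [x] of [W], either a class
    of the same degree on [W] without [x], or a class of one degree less on [W]
    without the closed neighbourhood of [x] ([ind_nz_del_link]). In a corona the
    closed neighbourhood of a base vertex [x] contains the copy of [H] attached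
    to it. If [H] has an edge then the maximum [r] for [H] is positive, so the
    degree lost with [x] is paid for by the [r] degrees that its copy of [H] could
    contribute. Without base vertices there remain disjoint copies of [H], whose
    independence complex is a join, and the Kunneth formula over a field
    ([join_acyclic], [join_cohom_nz]) shows that degrees add: the maximum is [r]
    times the number of base vertices. If [H] is null, [ind_nz W d] bounds [d] by
    the size of any vertex cover of [W] ([ind_nz_cover]); as soon as one side of
    the biclique is missing from [W], the other side is such a cover, and one
    side disappears with the first neighbourhood removed. The matching formed
    by one side and a leaf for each of its vertices attains the bound.

    Hochster's formula. The Betti numbers are compared with Koszul homology. If
    [Z'] is the module of relations among homogeneous generators of [Z], and
    these relations have no constant coefficient, then the Koszul homology of
    [Z] in homological degree [d + 1] is that of [Z'] in degree [d], because the
    Koszul complex of a free module is exact ([free_exact]). Going down a minimal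
    resolution, its [i]-th module has a generator in degree [j] exactly when the
    [i]-th Koszul homology of [S/I] is nonzero in degree [j]
    ([res_betti_neq0]). For an edge ideal the Koszul complex splits into strands
    indexed by multidegrees [b]. Each is the cochain complex of a simplicial
    complex: a cone if [b] is not squarefree, and, if [b] is the indicator of
    [W], the complex of independent subsets of [W] without isolated vertices of
    [G] ([hochster], [tor_edge_ideal]). The same argument shows that minimal
    resolutions exist ([min_res_exists]): the degrees in which a syzygy module
    needs generators are bounded by the number of variables. *)

(** * Choice, least numbers and antisymmetric sums *)

Lemma choice_fun (T : Type) (U : T -> Type) (R : forall x, U x -> Prop) :
  (forall x, exists y, R x y) -> exists f : forall x, U x, forall x, R x (f x).
Proof.
move=> H; exists (fun x => proj1_sig (constructive_indefinite_description _ (H x))) => x.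
exact: proj2_sig.
Qed.

Lemma ex_least (P : nat -> Prop) : (exists k, P k) ->
  exists k, P k /\ forall l, (l < k)%N -> ~ P l.
Proof.
case=> k; have [m] := ubnP k; elim: m k => // m IH k km Pk.
case: (classic (exists2 l, (l < k)%N & P l)) => [[l lk Pl]|no].
  by apply: IH Pl; apply: leq_trans lk _.
by exists k; split=> // l lk Pl; apply: no; exists l.
Qed.

(** The terms are cancelled in pairs across the diagonal, which is why the
    diagonal has to vanish by hypothesis: in characteristic 2 this does not
    follow from antisymmetry. *)
Lemma sum_antisym (V : finType) (M : zmodType) (F : V -> V -> M) :
  (forall a, F a a = 0) -> (forall a b, a != b -> F a b = - F b a) ->
  \sum_a \sum_b F a b = 0.
Proof.
move=> F0 FN; rewrite pair_bigA /=.
pose r (p : V * V) := (enum_rank p.1 < enum_rank p.2)%N.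
rewrite (bigID r) /= [X in _ + X](bigID (fun p : V * V => p.1 == p.2)) /=.
rewrite [X in _ + (X + _)]big1 ?add0r; last by move=> [a b] /= /andP[_ /eqP->].
have -> : \sum_(p | ~~ r p && (p.1 != p.2)) F p.1 p.2
        = \sum_(p | r p) F p.2 p.1.
  rewrite (reindex_inj (h := fun p : V * V => (p.2, p.1))) /=; last first.
    by move=> [a b] [c d] [-> ->].
  apply: eq_bigl => -[a b]; rewrite /r /= -leqNgt.
  have [->|ne] := eqVneq b a; first by rewrite leqnn ltnn.
  by rewrite andbT ltn_neqAle (inj_eq val_inj) (inj_eq enum_rank_inj) eq_sym ne.
rewrite -big_split /= big1 // => -[a b] /= rab.
rewrite (FN a b) ?addNr //; apply: contraTneq rab => ->.
by rewrite /r /= ltnn.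
Qed.

(** * Simplicial cochains over a field *)

Section Complex.
Variables (K : fieldType) (V : finType).
Implicit Types (D : pred {set V}) (e : V -> {set V} -> K) (z y : {set V} -> K).
Implicit Types (s t u A : {set V}) (a b x : V).

Definition down_closed D := forall s t, s \subset t -> D t -> D s.

(** The rules of signs for which the coboundary squares to zero. Keeping the
    rule a parameter lets links, joins and complements each use the signs
    that suit them, with no common order of the vertices. The
    anticommutation is asked on faces only, since [compl_sgn] satisfies it
    only for subsets of [W]. *)
Definition signs D e :=
  (forall a s, e a s * e a s = 1) /\
  (forall a b s, a != b -> a \notin s -> b \notin s -> D (a |: (b |: s)) ->
     e a s * e b (a |: s) = - (e b s * e a (b |: s))).

Definition cobd e z t := \sum_(a in t) e a (t :\ a) * z (t :\ a).

(** Nonvanishing of reduced cohomology in dimension [d - 1]; the empty face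
    is the case [d = 0]. A cochain is a function on all sets, and only its
    values on faces with the relevant number of vertices matter. *)
Definition cohom_nz e D d :=
  exists z, (forall t, D t -> #|t| = d.+1 -> cobd e z t = 0) /\
    ~ exists y, forall s, D s -> #|s| = d -> cobd e y s = z s.

Lemma signs_neq0 D e a s : signs D e -> e a s != 0.
Proof.
by case=> e1 _; apply: contra_eq_neq (e1 a s) => ->; rewrite mul0r eq_sym oner_eq0.
Qed.

Lemma signsS D D' e : (forall s, D' s -> D s) -> signs D e -> signs D' e.
Proof. by move=> DD [e1 e2]; split=> // a b s nab na nb /DD; apply: e2. Qed.

Lemma eq_cobd e z z' t : (forall a, a \in t -> z (t :\ a) = z' (t :\ a)) ->
  cobd e z t = cobd e z' t.
Proof. by move=> zz; apply: eq_bigr => a /zz->. Qed.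

Lemma cobdB e z z' t :
  cobd e (fun s => z s - z' s) t = cobd e z t - cobd e z' t.
Proof. by rewrite /cobd -sumrB; apply: eq_bigr => a _; rewrite mulrBr. Qed.

Lemma cobdD e z z' t :
  cobd e (fun s => z s + z' s) t = cobd e z t + cobd e z' t.
Proof. by rewrite /cobd -big_split; apply: eq_bigr => a _; rewrite mulrDr. Qed.

Lemma cobd_cobd D e z t : signs D e -> D t -> cobd e (cobd e z) t = 0.
Proof.
move=> [_ eN] Dt; pose F a b := if [&& a \in t, b \in t & a != b] then
  e a (t :\ a) * (e b (t :\ a :\ b) * z (t :\ a :\ b)) else 0.
transitivity (\sum_a \sum_b F a b).
  rewrite /cobd big_mkcond; apply: eq_bigr => a _.
  case: ifP => ta; last by rewrite big1 // => b _; rewrite /F ta.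
  rewrite mulr_sumr big_mkcond; apply: eq_bigr => b _.
  by rewrite /F ta !inE eq_sym andbC.
apply: sum_antisym => [a|a b nab]; rewrite /F; first by rewrite eqxx !andbF.
rewrite [b == a]eq_sym nab !andbT andbC; case: ifP => [/andP[tb ta]|_]; last by rewrite oppr0.
rewrite setDDl setUC -setDDl.
set s := t :\ b :\ a.
have sE : s = t :\ a :\ b by rewrite /s !setDDl setUC.
have -> : t :\ a = b |: s by rewrite sE setD1K // !inE eq_sym nab.
have -> : t :\ b = a |: s by rewrite /s setD1K // !inE nab.
have sa : a \notin s by rewrite !inE eqxx.
have sb : b \notin s by rewrite sE !inE eqxx.
have ts : a |: (b |: s) = t by rewrite sE !setD1K // !inE eq_sym nab.
have := eN _ _ _ nab sa sb; rewrite ts => /(_ Dt) E.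
by rewrite !mulrA -mulNr; congr (_ * _); rewrite [e b (a |: s) * _]mulrC E opprK mulrC.
Qed.

Lemma cohom_nz_size e D d : cohom_nz e D d -> exists2 s, D s & #|s| = d.
Proof.
case=> z [_ nb]; apply: NNPP => no; apply: nb; exists (fun=> 0) => s Ds sd.
by case: no; exists s.
Qed.

Lemma eq_cohom_nz e D D' d : D =1 D' -> cohom_nz e D d -> cohom_nz e D' d.
Proof.
move=> DD [z [zc zb]]; exists z; split=> [t|[y yb]]; first by rewrite -DD; apply: zc.
by apply: zb; exists y => s; rewrite DD; apply: yb.
Qed.

Fixpoint twist_rec e e' n s : K :=
  if n is m.+1 then
    if [pick a in s] is Some a then
      e a (s :\ a) * e' a (s :\ a) * twist_rec e e' m (s :\ a)
    else 1
  else 1.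
(** The product of the ratios of the two rules of signs while the vertices
    of [s] are removed one by one, in an arbitrary order. *)
Definition twist e e' s := twist_rec e e' #|s| s.

(** Both rules anticommute, so their ratio commutes, and the product of the
    ratios does not depend on the order in which the vertices are removed. *)
Lemma twistE D e e' a s : down_closed D -> signs D e -> signs D e' ->
  a \notin s -> D (a |: s) -> twist e e' (a |: s) = e a s * e' a s * twist e e' s.
Proof.
move=> dD [e1 eN] [f1 fN]; have [n] := ubnP #|s|; elim: n s a => // n IH s a sn sa Da.
(* [p] is the vertex that [twist] removes first. *)
have [p tp pt] : exists2 p, p \in a |: s & [pick x in a |: s] = Some p.
  by case: pickP => [p tp|/(_ a)]; [exists p | rewrite !inE eqxx].
have twp : twist e e' (a |: s)
         = e p ((a |: s) :\ p) * e' p ((a |: s) :\ p) * twist e e' ((a |: s) :\ p).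
  by rewrite /twist (cardsD1 p) tp add1n /= pt.
have [pa|npa] := eqVneq p a; first by rewrite twp pa setU1K.
have sp : p \in s by move: tp; rewrite !inE (negPf npa).
set r := s :\ p in twp *.
have sE : s = p |: r by rewrite setD1K.
have pr : p \notin r by rewrite !inE eqxx.
have ar : a \notin r by rewrite !inE (negPf sa) andbF.
have rE : (a |: s) :\ p = a |: r.
  by apply/setP=> x; rewrite !inE; case: (eqVneq x p) => [->|//]; rewrite (negPf npa).
have Dr x : D (x |: r) -> D r by apply: dD; apply: subsetUr.
have Dpr : D (p |: r) by rewrite -sE; apply: dD Da; apply: subsetUr.
have Dar : D (a |: r).
  by apply: dD Da; rewrite sE setUS // subsetUr.
have rn : (#|r| < n)%N.
  by move: sn; rewrite sE cardsU1 pr add1n ltnS; apply: leq_trans.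
rewrite twp rE (IH _ a) // [in RHS]sE (IH _ p) //.
rewrite sE in Da.
have E := eN _ _ _ npa pr ar; have F := fN _ _ _ npa pr ar.
have Da' : D (p |: (a |: r)) by rewrite setUCA.
have := congr2 *%R (E Da') (F Da'); rewrite mulrNN => G.
set w := twist e e' r.
transitivity (e a r * e p (a |: r) * (e' a r * e' p (a |: r)) * w); first by ring.
by rewrite -G; ring.
Qed.

Lemma twist2 e e' D s : signs D e -> signs D e' -> twist e e' s * twist e e' s = 1.
Proof.
move=> [e1 _] [f1 _]; rewrite /twist; move: #|s| => n.
elim: n s => [|n IH] s /=; first by rewrite mulr1.
case: pickP => [a _|_]; last by rewrite mulr1.
by rewrite mulrACA IH mulr1 mulrACA e1 f1 mulr1.
Qed.

(** Multiplication by the twist, whose square is 1, carries one coboundary to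
    the other. *)
Lemma cohom_nz_sign D e e' d : down_closed D -> signs D e -> signs D e' ->
  cohom_nz e D d -> cohom_nz e' D d.
Proof.
move=> dD se se'; pose r := twist e e'.
have tw z t : D t -> cobd e' (fun s => r s * z s) t = r t * cobd e z t.
  move=> Dt; rewrite mulr_sumr; apply: eq_bigr => a ta.
  have := @twistE D e e' a (t :\ a) dD se se'.
  rewrite setD1K // -/r => -> //; last by rewrite !inE eqxx.
  case: se se' => e1 _ [f1 _].
  transitivity (e a (t :\ a) * e a (t :\ a) * (e' a (t :\ a) * (r (t :\ a) * z (t :\ a)))).
    by rewrite e1 mul1r.
  by ring.
case=> z [zc zb]; exists (fun s => r s * z s); split=> [t Dt td|[y yb]].
  by rewrite tw // zc // mulr0.
apply: zb; exists (fun s => r s * y s) => s Ds sd.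
have : r s * cobd e (fun s => r s * y s) s = r s * z s.
  rewrite -tw // -yb //; apply: eq_cobd => a _.
  by rewrite mulrA (twist2 _ se se') mul1r.
by move/(congr1 ( *%R (r s))); rewrite !mulrA (twist2 _ se se') !mul1r.
Qed.
End Complex.

(** * Cones, links and changes of vertices *)

Section Cochains.
Variables (K : fieldType) (V : finType).
Implicit Types (D : pred {set V}) (e : V -> {set V} -> K) (z y : {set V} -> K).
Implicit Types (s t u A : {set V}) (a b x : V).

Lemma setU1D1 x a s : x != a -> (x |: s) :\ a = x |: (s :\ a).
Proof.
move=> xa; apply/setP=> b; rewrite !inE.
by have [->|_] := eqVneq b x; rewrite ?xa.
Qed.

Lemma cobd_setU1 e z x s : x \notin s ->
  cobd e z (x |: s) = e x s * z s + \sum_(a in s) e a (x |: (s :\ a)) * z (x |: (s :\ a)).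
Proof.
move=> xs; rewrite /cobd big_setU1 //= setU1K //; congr (_ + _).
apply: eq_bigr => a sa; rewrite setU1D1 //.
by apply: contraNneq xs => ->.
Qed.

Lemma cohom_nzN e D d z : ~ cohom_nz e D d ->
  (forall t, D t -> #|t| = d.+1 -> cobd e z t = 0) ->
  exists y, forall s, D s -> #|s| = d -> cobd e y s = z s.
Proof. by move=> nz zc; apply: NNPP => nb; apply: nz; exists z. Qed.

(** The cone is contracted towards its apex [x] by sending a cochain [z] to
    the cochain with value [z (x |: s)] at [s], up to sign. *)
Lemma cone_acyclic e D x d : signs D e -> (forall s, D s -> D (x |: s)) ->
  ~ cohom_nz e D d.
Proof.
move=> [e1 eN] Dx [z [zc nb]]; apply: nb.
exists (fun s => if x \in s then 0 else e x s * z (x |: s)) => s Ds sd.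
case: (boolP (x \in s)) => xs.
  rewrite /cobd (bigD1 x) //= !inE eqxx /= mulrA e1 mul1r setD1K //.
  rewrite big1 ?addr0 // => a /andP[sa ax].
  by rewrite !inE eq_sym ax xs mulr0.
have := zc (x |: s) (Dx _ Ds); rewrite cardsU1 xs add1n sd => /(_ erefl).
rewrite cobd_setU1 // => /eqP; rewrite addr_eq0 => /eqP E.
rewrite -[RHS]mul1r -(e1 x s) -mulrA E mulrN mulr_sumr -sumrN.
apply: eq_bigr => a sa; set r := s :\ a.
have ar : a \notin r by rewrite !inE eqxx.
have xr : x \notin r by rewrite !inE (negPf xs) andbF.
have ax : a != x by apply: contraNneq xs => <-.
have sE : s = a |: r by rewrite setD1K.
rewrite (negPf xr).
have := eN a x r ax ar xr; rewrite setUCA -sE => /(_ (Dx _ Ds)) F.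
transitivity ((e a r * e x s) * (e x s * e x r) * z (x |: r)).
  by rewrite -[LHS]mul1r -(e1 x s); ring.
by rewrite F -[RHS]mul1r -(e1 x r); ring.
Qed.

(** Exactness of link, complex, deletion: a cocycle trivial on the deletion
    can be corrected so as to vanish away from [x], and is then a cocycle of
    the link. *)
Lemma cohom_del_link e D x d : down_closed D -> signs D e ->
  cohom_nz e D d.+1 ->
  cohom_nz e [pred s : {set V} | D s && (x \notin s)] d.+1 \/
  cohom_nz e [pred s : {set V} | (x \notin s) && D (x |: s)] d.
Proof.
move=> dD se [z [zc nb]].
set del := [pred s | _]; set lk := [pred s | _].
case: (classic (cohom_nz e del d.+1)) => [|nd]; first by left.
case: (classic (cohom_nz e lk d)) => [|nl]; first by right.
case: nb.
have lkD s : lk s -> D s by move=> /andP[_]; apply: dD; apply: subsetUr.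
pose ex a s := e a (x |: s).
have dlk : down_closed lk.
  move=> s t st /andP[xt Dt] /=; rewrite (contra _ xt) /=; last exact: (subsetP st).
  by apply: dD Dt; apply: setUS.
have sx : signs lk ex.
  case: se => e1 eN; split=> [a s|a b s ab na nb /andP[]]; first exact: e1.
  rewrite !inE !negb_or => /and3P[xa xb xs] H; rewrite /ex.
  rewrite ![x |: (_ |: s)]setUCA eN // ?inE ?negb_or ?na ?nb ?andbT 1?eq_sym //.
  by rewrite [b |: _]setUCA [a |: _]setUCA.
have {}nl : ~ cohom_nz ex lk d.
  by move=> /(cohom_nz_sign dlk sx (signsS lkD se)).
(* [y1] makes [z] vanish on the deletion; [y2] lives on the link. *)
have [|y1 y1E] := cohom_nzN (z := z) nd.
  by move=> t /andP[Dt _]; apply: zc.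
pose z' s := z s - cobd e y1 s.
have z'c t : D t -> #|t| = d.+2 -> cobd e z' t = 0.
  by move=> Dt td; rewrite cobdB zc // (cobd_cobd _ se Dt) subr0.
have z'0 s : D s -> x \notin s -> #|s| = d.+1 -> z' s = 0.
  by move=> Ds xs sd; rewrite /z' y1E ?subrr //=; apply/andP.
have [|y2 y2E] := cohom_nzN (z := fun s => z' (x |: s)) nl.
  move=> t /andP[xt Dt] td.
  have := z'c (x |: t) Dt; rewrite cardsU1 xt td => /(_ erefl).
  rewrite cobd_setU1 // z'0 ?mulr0 ?add0r //.
  by apply: dD Dt; apply: subsetUr.
pose y2' s := if x \in s then y2 (s :\ x) else 0.
exists (fun s => y1 s + y2' s) => s Ds sd; rewrite cobdD.
suff -> : cobd e y2' s = z' s by rewrite /z' addrC subrK.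
case: (boolP (x \in s)) => xs; last first.
  rewrite z'0 //; apply: big1 => a sa.
  by rewrite /y2' !inE (negPf xs) andbF mulr0.
set r := s :\ x; have xr : x \notin r by rewrite !inE eqxx.
have sE : s = x |: r by rewrite setD1K.
rewrite sE cobd_setU1 // {1}/y2' (negPf xr) mulr0 add0r.
rewrite -y2E //=; last by move: sd; rewrite sE cardsU1 xr => -[].
  rewrite /cobd; apply: eq_bigr => a ra; rewrite /y2' !inE eqxx /= setU1K //.
  by rewrite !inE eqxx andbF.
by rewrite xr -sE.
Qed.

Definition order_sgn a s : K := (-1) ^+ #|[set b in s | (enum_rank b < enum_rank a)%N]|.

Lemma order_sgnU1 a b s : b \notin s ->
  order_sgn a (b |: s) = order_sgn a s * (-1) ^+ (enum_rank b < enum_rank a)%N.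
Proof.
move=> bs; rewrite /order_sgn -exprD; congr (_ ^+ _).
rewrite (cardsD1 b) !inE eqxx /= addnC; congr (_ + _)%N; congr #|pred_of_set _|.
by apply/setP=> c; rewrite !inE; case: eqVneq => [->|] //=; rewrite (negPf bs).
Qed.

Lemma order_sgn_signs D : signs D order_sgn.
Proof.
split=> [a s|a b s ab na nb _]; first by rewrite -expr2 sqrr_sign.
rewrite !order_sgnU1 // !mulrA [order_sgn b s * _]mulrC -mulrN; congr (_ * _).
case: ltngtP => //= h; rewrite ?expr1 ?expr0 ?opprK //.
by move: ab; rewrite -(inj_eq enum_rank_inj) (val_inj h) eqxx.
Qed.

(** No cochain precedes those on the empty face, so that none of these is a
    coboundary. *)
Lemma cohom_nz_empty e D : D set0 -> (forall t, D t -> #|t| = 1%N -> False) -> cohom_nz e D 0.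
Proof.
move=> D0 D1; exists (fun=> 1); split=> [t Dt t1|[y yb]]; first by case: (D1 t).
have := yb set0 D0 (cards0 _); rewrite /cobd big_set0 => /eqP.
by rewrite eq_sym oner_eq0.
Qed.

(** The indicator of one of the points is not constant. *)
Lemma cohom_two_points e D a b : signs D e -> a != b -> D [set a] -> D [set b] ->
  (forall t, D t -> #|t| = 2%N -> False) -> cohom_nz e D 1.
Proof.
move=> se ab Da Db D2; exists (fun s => (s == [set a])%:R); split=> [t Dt t2|[y yb]].
  by case: (D2 t).
have cob1 c : cobd e y [set c] = e c set0 * y set0.
  by rewrite /cobd big_set1 setDv.
have := yb _ Db (cards1 _); have := yb _ Da (cards1 _).
rewrite !cob1 eqxx (inj_eq set1_inj) eq_sym (negPf ab) => ha /eqP.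
rewrite mulf_eq0 (negPf (signs_neq0 _ _ se)) /= => /eqP y0.
by move/eqP: ha; rewrite y0 mulr0 eq_sym oner_eq0.
Qed.
End Cochains.

Section Embed.
Variables (K : fieldType) (V V' : finType) (f : V -> V').
Hypothesis f_inj : injective f.

Lemma imsetD1 (s : {set V}) a : f @: (s :\ a) = (f @: s) :\ f a.
Proof.
apply/setP=> b; rewrite !inE; apply/imsetP/andP.
  case=> c; rewrite !inE => /andP[ca sc] ->; rewrite (inj_eq f_inj); split=> //.
  exact: imset_f.
by case=> ba /imsetP[c sc bE]; exists c => //; rewrite !inE sc -(inj_eq f_inj) -bE ba.
Qed.

Lemma cobd_imset (e : V' -> {set V'} -> K) z (s : {set V}) :
  cobd e z (f @: s) =
  cobd (fun a (s : {set V}) => e (f a) (f @: s)) (fun s : {set V} => z (f @: s)) s.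
Proof.
rewrite /cobd big_imset /=; last by move=> ? ? _ _; apply: f_inj.
by apply: eq_bigr => a _; rewrite imsetD1.
Qed.

Lemma cohom_nz_imset (e : V' -> {set V'} -> K) (D : pred {set V}) (D' : pred {set V'}) d :
  (forall s : {set V}, D' (f @: s) = D s) -> (forall t, D' t -> exists s : {set V}, t = f @: s) ->
  cohom_nz e D' d <-> cohom_nz (fun a (s : {set V}) => e (f a) (f @: s)) D d.
Proof.
move=> DE Dim; have fc (s : {set V}) := card_imset s f_inj.
have fK (s : {set V}) : f @^-1: (f @: s) = s.
  by apply/setP=> a; rewrite inE mem_imset.
split=> -[z [zc nb]].
  exists (fun s : {set V} => z (f @: s)); split=> [t Dt td|[y yb]].
    by rewrite -cobd_imset; apply: zc; rewrite ?DE ?fc.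
  apply: nb; exists (fun t : {set V'} => y (f @^-1: t)) => t D't; have [s tE] := Dim _ D't.
  rewrite tE fc => sd; rewrite cobd_imset -yb // -?DE -?tE //.
  by apply: eq_cobd => a _; rewrite fK.
exists (fun t : {set V'} => z (f @^-1: t)); split=> [t D't|[y yb]].
  have [s tE] := Dim _ D't; rewrite tE fc => sd.
  rewrite cobd_imset -[RHS](zc s) // -?DE -?tE //.
  by apply: eq_cobd => a _; rewrite fK.
apply: nb; exists (fun s : {set V} => y (f @: s)) => s Ds sd.
by rewrite -cobd_imset yb ?fK ?DE ?fc.
Qed.

Lemma signs_imset (e : V' -> {set V'} -> K) (D : pred {set V}) (D' : pred {set V'}) :
  (forall s : {set V}, D' (f @: s) = D s) -> signs D' e ->
  signs D (fun a (s : {set V}) => e (f a) (f @: s)).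
Proof.
move=> DE [e1 eN]; split=> [a s|a b s ab na nb Dab]; first exact: e1.
have fU c (r : {set V}) : f @: (c |: r) = f c |: f @: r by rewrite imsetU1.
rewrite !fU; apply: eN; rewrite ?(inj_eq f_inj) ?mem_imset // -!fU DE //.
Qed.
End Embed.

(** * Contractions and dual cycles *)

Section LinAlg.
Variables (K : fieldType) (V : finType) (D : pred {set V}).
Variable (e : V -> {set V} -> K).
Hypotheses (dD : down_closed D) (se : signs D e).
Local Notation N := #|{set V}|.
Implicit Types (s t u : {set V}).

Definition fun_of_row (v : 'rV[K]_N) s := v 0 (enum_rank s).
Definition row_of_fun (z : {set V} -> K) : 'rV[K]_N := \row_q z (enum_val q).
(** Cochains become row vectors indexed by all sets, on which matrices act
    on the right: [face_mx i] projects onto the cochains carried by faces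
    with [i] vertices, and [cobd_mx i] is the coboundary from degree [i - 1]
    into degree [i]. *)
Definition face_mx i : 'M[K]_N := \matrix_(p, q)
  ((p == q) && (D (enum_val q) && (#|enum_val q| == i)))%:R.
Definition cobd_mx i : 'M[K]_N := \matrix_(p, q)
  if D (enum_val q) && (#|enum_val q| == i) then
    \sum_(a in enum_val q) e a (enum_val q :\ a) * (enum_val p == enum_val q :\ a)%:R
  else 0.

Lemma sum_enum_rank (F : 'I_N -> K) : \sum_q F q = \sum_s F (enum_rank s).
Proof. by rewrite (reindex (@enum_rank _)) //; apply: onW_bij; apply: enum_rank_bij. Qed.

Lemma row_of_funK z s : fun_of_row (row_of_fun z) s = z s.
Proof. by rewrite /fun_of_row mxE enum_rankK. Qed.

Lemma fun_of_rowP (v w : 'rV[K]_N) : (forall s, fun_of_row v s = fun_of_row w s) -> v = w.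
Proof. by move=> vw; apply/rowP=> q; have := vw (enum_val q); rewrite /fun_of_row enum_valK. Qed.

Lemma fun_face_mx v i s : fun_of_row (v *m face_mx i) s =
  if D s && (#|s| == i) then fun_of_row v s else 0.
Proof.
rewrite /fun_of_row mxE (bigD1 (enum_rank s)) //= big1 ?addr0 => [|q /negPf qs].
  by rewrite mxE eqxx enum_rankK /=; case: ifP; rewrite ?mulr1 ?mulr0.
by rewrite mxE qs mulr0.
Qed.

Lemma fun_cobd_mx v i s : fun_of_row (v *m cobd_mx i) s =
  if D s && (#|s| == i) then cobd e (fun_of_row v) s else 0.
Proof.
rewrite /fun_of_row mxE; case: ifP => Ds; last first.
  by rewrite big1 // => q _; rewrite mxE enum_rankK Ds mulr0.
under eq_bigr do rewrite mxE enum_rankK Ds mulr_sumr.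
rewrite exchange_big; apply: eq_bigr => a sa /=.
rewrite sum_enum_rank (bigD1 (s :\ a)) //= big1 ?addr0 => [|t /negPf ts].
  by rewrite enum_rankK eqxx mulr1 mulrC.
by rewrite enum_rankK ts !mulr0.
Qed.

Lemma mx_actP (X Y : 'M[K]_N) :
  (forall v s, fun_of_row (v *m X) s = fun_of_row (v *m Y) s) -> X = Y.
Proof. by move=> XY; apply/row_matrixP=> i; rewrite !rowE; apply: fun_of_rowP. Qed.

Lemma face_mx_idem i : face_mx i *m face_mx i = face_mx i.
Proof. by apply: mx_actP => v s; rewrite mulmxA !fun_face_mx; case: (_ && _). Qed.

Lemma face_mul_cobd i : face_mx i *m cobd_mx i.+1 = cobd_mx i.+1.
Proof.
apply: mx_actP => v s; rewrite mulmxA !fun_cobd_mx; case: ifP => // /andP[Ds si].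
apply: eq_cobd => a sa; rewrite fun_face_mx (dD _ Ds) ?subD1set //.
by move: si; rewrite (cardsD1 a) sa add1n eqSS => ->.
Qed.

Lemma cobd_mul_face i : cobd_mx i *m face_mx i = cobd_mx i.
Proof. by apply: mx_actP => v s; rewrite mulmxA fun_face_mx fun_cobd_mx; case: (_ && _). Qed.

Lemma cobd_mul_cobd i : cobd_mx i *m cobd_mx i.+1 = 0.
Proof.
apply: mx_actP => v s; rewrite mulmxA fun_cobd_mx mulmx0 [RHS]mxE.
case: ifP => // /andP[Ds si]; rewrite -[RHS](cobd_cobd (fun_of_row v) se Ds).
apply: eq_cobd => a sa; rewrite fun_cobd_mx (dD _ Ds) ?subD1set //.
by move: si; rewrite (cardsD1 a) sa add1n eqSS => ->.
Qed.

Lemma cocycle_submx i (X : 'M[K]_N) : ~ cohom_nz e D i ->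
  X *m cobd_mx i.+1 = 0 -> X *m face_mx i = X -> (X <= cobd_mx i)%MS.
Proof.
move=> nz XC XE; apply/row_subP=> j; set v := row j X.
have vC : v *m cobd_mx i.+1 = 0 by rewrite -row_mul XC row0.
have vE : v *m face_mx i = v by rewrite -row_mul XE.
have [|y yE] := cohom_nzN (z := fun_of_row v) nz.
  move=> t Dt ti; have := fun_cobd_mx v i.+1 t.
  by rewrite vC Dt ti eqxx /= /fun_of_row [in LHS]mxE => <-.
suff -> : v = row_of_fun y *m cobd_mx i by apply: submxMl.
apply: fun_of_rowP => s; rewrite -[in LHS]vE fun_face_mx fun_cobd_mx.
case: ifP => // /andP[Ds /eqP si]; rewrite -yE //.
by apply: eq_cobd => a _; rewrite row_of_funK.
Qed.

(** A projection onto the cocycles with [i] vertices, parallel to the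
    complement that the generalized inverse of the coboundary provides. *)
Definition cocycle_mx i : 'M[K]_N := face_mx i - cobd_mx i.+1 *m pinvmx (cobd_mx i.+1) *m face_mx i.
Definition contraction_mx i : 'M[K]_N := cocycle_mx i.+1 *m pinvmx (cobd_mx i.+1) *m face_mx i.

(** The identity [d t + t d = 1], in a degree without cohomology. *)
Lemma homotopy_mx i : ~ cohom_nz e D i.+1 ->
  cobd_mx i.+2 *m contraction_mx i.+1 + contraction_mx i *m cobd_mx i.+1 = face_mx i.+1.
Proof.
move=> nz.
have CX : cobd_mx i.+2 *m cocycle_mx i.+2 = cobd_mx i.+2.
  by rewrite mulmxBr cobd_mul_face !mulmxA cobd_mul_cobd !mul0mx subr0.
have XC : cocycle_mx i.+1 *m cobd_mx i.+2 = 0.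
  rewrite /cocycle_mx mulmxBl face_mul_cobd -(mulmxA _ (face_mx _)) face_mul_cobd.
  by rewrite mulmxKpV ?submx_refl // subrr.
have XE : cocycle_mx i.+1 *m face_mx i.+1 = cocycle_mx i.+1.
  by rewrite /cocycle_mx mulmxBl face_mx_idem -(mulmxA _ (face_mx _)) face_mx_idem.
have Xs := cocycle_submx nz XC XE.
rewrite /contraction_mx 2!mulmxA CX -(mulmxA _ (face_mx i)) face_mul_cobd mulmxKpV //.
by rewrite /cocycle_mx addrC subrK.
Qed.

Lemma contraction_mx_supp i s t :
  contraction_mx i (enum_rank s) (enum_rank t) != 0 -> D s /\ #|s| = i.+1.
Proof.
have -> : contraction_mx i = face_mx i.+1 *m contraction_mx i.
  rewrite /contraction_mx !mulmxA; congr (_ *m _ *m _).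
  by rewrite /cocycle_mx mulmxBr face_mx_idem !mulmxA face_mul_cobd.
rewrite mxE (bigD1 (enum_rank s)) //= [X in _ + X]big1 ?addr0; last first.
  by move=> q /negPf qs; rewrite mxE eq_sym qs mul0r.
rewrite [face_mx _ _ _]mxE eqxx enum_rankK /=.
by case: andP => [[Ds /eqP]|]; rewrite ?mul0r ?eqxx.
Qed.

(** The homotopy is a kernel, hence linear, and so commutes with operations
    on another factor of a join; a primitive chosen separately for each
    cocycle would not. Its existence depends on [K] being a field. *)
Lemma contraction h : (forall i, (h < i)%N -> ~ cohom_nz e D i) ->
  exists S : {set V} -> {set V} -> K,
    (forall s t, S s t != 0 -> D s /\ #|s| = #|t|.+1) /\
    forall z s, D s -> (h < #|s|)%N ->
      \sum_t S t s * cobd e z t + cobd e (fun u => \sum_t S t u * z t) s = z s.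
Proof.
move=> nz; exists (fun s t => contraction_mx #|t| (enum_rank s) (enum_rank t)).
split=> [s t|z s Ds]; first exact: contraction_mx_supp.
case si: #|s| => [|i] // hi.
have := congr1 (fun A => fun_of_row (row_of_fun z *m A) s) (homotopy_mx (nz _ hi)).
rewrite fun_face_mx Ds si eqxx /= row_of_funK => <-.
rewrite mulmxDr (mulmxA _ (cobd_mx _)) (mulmxA _ (contraction_mx _)).
have rowD v w : fun_of_row (v + w) s = fun_of_row v s + fun_of_row w s by rewrite /fun_of_row mxE.
rewrite rowD; congr (_ + _).
  rewrite /fun_of_row mxE sum_enum_rank; apply: eq_bigr => t _.
  have [->|/contraction_mx_supp [Dt ti]] :=
    eqVneq (contraction_mx i.+1 (enum_rank t) (enum_rank s)) 0.
    by rewrite mulr0 mul0r.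
  rewrite -/(fun_of_row _ _) fun_cobd_mx Dt ti eqxx /= mulrC; congr (_ * _).
  by apply: eq_cobd => a _; rewrite row_of_funK.
rewrite fun_cobd_mx Ds si eqxx /=; apply: eq_cobd => a sa.
rewrite /fun_of_row mxE sum_enum_rank; apply: eq_bigr => t _.
have -> : #|s :\ a| = i by move: si; rewrite (cardsD1 a) sa => -[].
by rewrite -/(fun_of_row _ _) row_of_funK mulrC.
Qed.

(** A nonzero class is detected by a linear form that kills all
    coboundaries. In a join such pairings multiply, whereas the property of
    not being a coboundary is hard to handle directly. *)
Lemma dual_cycle d : cohom_nz e D d -> exists z w : {set V} -> K,
  [/\ forall t, D t -> #|t| = d.+1 -> cobd e z t = 0,
      forall s, w s != 0 -> D s /\ #|s| = d,
      forall y, \sum_s w s * cobd e y s = 0 &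
      \sum_s w s * z s = 1].
Proof.
case=> z [zc nb]; exists z; set v := row_of_fun z *m face_mx d.
have /negP : ~ (v <= cobd_mx d)%MS.
  case/submxP=> y yE; apply: nb; exists (fun_of_row y) => s Ds sd.
  have := fun_cobd_mx y d s; rewrite -yE fun_face_mx Ds sd eqxx /= row_of_funK //.
rewrite submxE => /matrix0Pn [i [j]]; rewrite ord1 => {i}.
set Q := cokermx _ => c0.
pose w s := if D s && (#|s| == d) then Q (enum_rank s) j / (v *m Q) 0 j else 0.
have wE z' : \sum_s w s * z' s = (row_of_fun z' *m face_mx d *m Q) 0 j / (v *m Q) 0 j.
  rewrite [X in X / _]mxE sum_enum_rank mulr_suml; apply: eq_bigr => s _.
  rewrite -/(fun_of_row _ _) fun_face_mx row_of_funK /w.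
  by case: ifP; rewrite ?mul0r // => _; rewrite mulrAC [Q _ _ * _]mulrC.
exists w; split=> //.
- by move=> s; rewrite /w; case: ifP => [/andP[Ds /eqP]|]; rewrite ?eqxx.
- move=> y; rewrite wE.
  have -> : row_of_fun (cobd e y) *m face_mx d = row_of_fun y *m cobd_mx d.
    apply: fun_of_rowP => s; rewrite fun_face_mx fun_cobd_mx row_of_funK.
    by case: ifP => // _; apply: eq_cobd => a _; rewrite row_of_funK.
  by rewrite -mulmxA mulmx_coker mulmx0 mxE mul0r.
by rewrite wE -/v divff.
Qed.
End LinAlg.

(** * Joins of complexes *)

Section Join.
Variables (K : fieldType) (V : finType) (A : {set V}) (D1 D2 D : pred {set V}).
Variable (e : V -> {set V} -> K).
Hypotheses (dD1 : down_closed D1) (dD2 : down_closed D2).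
Hypotheses (D1A : forall s, D1 s -> s \subset A).
Hypotheses (D2A : forall s, D2 s -> s \subset ~: A).
Hypotheses (DE : forall u, D u = D1 (u :&: A) && D2 (u :\: A)).
Hypotheses (s1 : signs D1 e) (s2 : signs D2 e).
Implicit Types (s t u : {set V}) (a b : V).

(** With these signs the cochain complex of a join is the tensor product of
    the two complexes, with the usual sign on the second differential
    ([cobd_join]). *)
Definition join_sgn a s : K :=
  if a \in A then e a (s :&: A) else (-1) ^+ #|s :&: A| * e a (s :\: A).

Lemma joinI s t : s \subset A -> t \subset ~: A -> (s :|: t) :&: A = s.
Proof.
move=> sA tA; rewrite setIUl (setIidPl sA).
by move: tA; rewrite subsets_disjoint setCK -setI_eq0 => /eqP->; rewrite setU0.
Qed.

Lemma joinD s t : s \subset A -> t \subset ~: A -> (s :|: t) :\: A = t.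
Proof.
move=> sA tA; rewrite setDUl; move: sA; rewrite -setD_eq0 => /eqP->.
by rewrite set0U setDE (setIidPl tA).
Qed.

Lemma join_decomp u : u = (u :&: A) :|: (u :\: A).
Proof. by rewrite setID. Qed.

Lemma joinDE s t : D1 s -> D2 t -> D (s :|: t).
Proof.
move=> Ds Dt; have sA := D1A Ds; have tA := D2A Dt.
by rewrite DE joinI // joinD // Ds Dt.
Qed.

Lemma join_card s t : s \subset A -> t \subset ~: A -> #|s :|: t| = (#|s| + #|t|)%N.
Proof.
move=> sA tA; apply/eqP; rewrite (leq_card_setU s t).
rewrite disjoints_subset; apply: subset_trans sA _.
by rewrite -setCS setCK.
Qed.

Lemma join_down : down_closed D.
Proof.
move=> s t st; rewrite !DE => /andP[D1t D2t].
by rewrite (dD1 _ D1t) ?setSI // (dD2 _ D2t) ?setSD.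
Qed.

Lemma join_signs : signs D join_sgn.
Proof.
have [e1 eN1] := s1; have [_ eN2] := s2.
have UI a s : (a |: s) :&: A = if a \in A then a |: (s :&: A) else s :&: A.
  rewrite setIUl; case: ifP => aA; first by rewrite (setIidPl _) // sub1set.
  suff -> : [set a] :&: A = set0 by rewrite set0U.
  by apply/setP=> x; rewrite !inE; case: eqVneq => [->|].
have UD a s : (a |: s) :\: A = if a \in A then s :\: A else a |: (s :\: A).
  rewrite setDUl; case: ifP => aA.
    suff -> : [set a] :\: A = set0 by rewrite set0U.
    by apply/setP=> x; rewrite !inE; case: eqVneq => [->|]; rewrite ?aA ?andbF.
  congr (_ :|: _); apply/setP=> x; rewrite !inE.
  by case: eqVneq => [->|]; rewrite ?aA ?andbF.
split=> [a s|a b s ab na nb].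
  rewrite /join_sgn; case: ifP => _; first exact: e1.
  by rewrite mulrACA e1 mulr1 -expr2 sqrr_sign.
rewrite DE !UI !UD /join_sgn !UI !UD => /andP[Da Db].
case: ifP Da Db => aA; case: ifP => bA Da Db.
- by apply: eN1; rewrite // !inE ?(negPf na) ?(negPf nb).
- rewrite cardsU1 !inE (negPf na) /= exprS; ring.
- rewrite cardsU1 !inE (negPf nb) /= exprS; ring.
- have := eN2 a b (s :\: A) ab; rewrite !inE !(negPf na, negPf nb) !andbF.
  move=> /(_ isT isT Db) E.
  transitivity ((-1) ^+ #|s :&: A| * (-1) ^+ #|s :&: A|
     * (e a (s :\: A) * e b (a |: (s :\: A)))); first by ring.
  by rewrite E; ring.
Qed.

Lemma cobd_join z s t : s \subset A -> t \subset ~: A ->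
  cobd join_sgn z (s :|: t) = cobd e (fun s' => z (s' :|: t)) s
    + (-1) ^+ #|s| * cobd e (fun t' => z (s :|: t')) t.
Proof.
move=> sA tA; rewrite /cobd (big_setID A) /= joinI // joinD //.
congr (_ + _).
  apply: eq_bigr => a sa; have aA : a \in A by apply: (subsetP sA).
  have -> : (s :|: t) :\ a = (s :\ a) :|: t.
    rewrite setDUl; congr (_ :|: _); apply/setDidPl.
    rewrite disjoint_sym disjoints1; apply/negP=> /(subsetP tA).
    by rewrite inE aA.
  by rewrite /join_sgn aA joinI // (subset_trans _ sA) // subD1set.
rewrite mulr_sumr; apply: eq_bigr => a ta.
have aA : a \notin A by have := subsetP tA _ ta; rewrite inE.
have -> : (s :|: t) :\ a = s :|: (t :\ a).
  rewrite setDUl; congr (_ :|: _); apply/setDidPl.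
  by rewrite disjoint_sym disjoints1; apply: contra aA; apply/subsetP.
have tA' : t :\ a \subset ~: A by rewrite (subset_trans _ tA) // subD1set.
by rewrite /join_sgn (negPf aA) joinI // joinD // mulrA.
Qed.

Lemma cobd_sum (I : finType) (c : I -> K) (z : I -> {set V} -> K) (ee : V -> {set V} -> K) t :
  cobd ee (fun s => \sum_i c i * z i s) t = \sum_i c i * cobd ee (z i) t.
Proof.
rewrite /cobd; under eq_bigr do rewrite mulr_sumr.
rewrite exchange_big; apply: eq_bigr => i _ /=; rewrite mulr_sumr.
by apply: eq_bigr => a _; rewrite mulrCA.
Qed.

Lemma cobdZ (ee : V -> {set V} -> K) c z t :
  cobd ee (fun s => c * z s) t = c * cobd ee z t.
Proof. by rewrite mulr_sumr; apply: eq_bigr => a _; rewrite mulrCA. Qed.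

Section Homotopies.
Variables S1 S2 : {set V} -> {set V} -> K.
Hypothesis S1supp : forall s t, S1 s t != 0 -> D1 s /\ #|s| = #|t|.+1.
Hypothesis S2supp : forall s t, S2 s t != 0 -> D2 s /\ #|s| = #|t|.+1.

Definition homotopy_l z u := \sum_s S1 s (u :&: A) * z (s :|: (u :\: A)).
Definition homotopy_r z u : K :=
  (-1) ^+ #|u :&: A| * \sum_t S2 t (u :\: A) * z ((u :&: A) :|: t).

(** The two contributions of the second factor cancel, since the homotopy
    changes the parity of the number of vertices in [A]. *)
Lemma homotopy_lE z s t : D1 s -> D2 t ->
  cobd join_sgn (homotopy_l z) (s :|: t) + \sum_s' S1 s' s * cobd join_sgn z (s' :|: t)
  = \sum_s' S1 s' s * cobd e (fun r => z (r :|: t)) s'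
    + cobd e (fun r => \sum_s' S1 s' r * z (s' :|: t)) s.
Proof.
move=> Ds Dt; have sA := D1A Ds; have tA := D2A Dt.
have sub1 (r B : {set V}) a : r \subset B -> r :\ a \subset B.
  exact: subset_trans (subD1set _ _).
rewrite cobd_join //.
rewrite (@eq_cobd _ _ e _ (fun r => \sum_s' S1 s' r * z (s' :|: t)) s); last first.
  by move=> a sa; rewrite /homotopy_l joinI ?joinD ?sub1.
rewrite (@eq_cobd _ _ e _ (fun r => \sum_s' S1 s' s * z (s' :|: r)) t); last first.
  by move=> a ta; rewrite /homotopy_l joinI ?joinD ?sub1.
rewrite [RHS]addrC -addrA; congr (_ + _).
rewrite cobd_sum mulr_sumr -big_split; apply: eq_bigr => s' _ /=.
have [->|/S1supp [Ds' cs']] := eqVneq (S1 s' s) 0; first by ring.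
by rewrite cobd_join ?D1A // cs' exprS; ring.
Qed.

Lemma homotopy_rE z s t : D1 s -> D2 t ->
  cobd join_sgn (homotopy_r z) (s :|: t)
    + (-1) ^+ #|s| * \sum_t' S2 t' t * cobd join_sgn z (s :|: t')
  = \sum_t' S2 t' t * cobd e (fun r => z (s :|: r)) t'
    + cobd e (fun r => \sum_t' S2 t' r * z (s :|: t')) t.
Proof.
move=> Ds Dt; have sA := D1A Ds; have tA := D2A Dt.
have sub1 (r B : {set V}) a : r \subset B -> r :\ a \subset B.
  exact: subset_trans (subD1set _ _).
rewrite cobd_join //.
rewrite (@eq_cobd _ _ e _ (fun r => - (-1) ^+ #|s| * \sum_t' S2 t' t * z (r :|: t')) s); last first.
  move=> a sa; rewrite /homotopy_r joinI ?joinD ?sub1 //; congr (_ * _).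
  by rewrite (cardsD1 a s) sa exprS; ring.
rewrite (@eq_cobd _ _ e _ (fun r => (-1) ^+ #|s| * \sum_t' S2 t' r * z (s :|: t')) t); last first.
  by move=> a ta; rewrite /homotopy_r joinI ?joinD ?sub1.
rewrite !cobdZ mulrA -expr2 sqrr_sign mul1r addrAC; congr (_ + _).
rewrite cobd_sum mulNr addrC -mulrBr -sumrB mulr_sumr; apply: eq_bigr => t' _ /=.
have [->|/S2supp [Dt' ct']] := eqVneq (S2 t' t) 0; first by ring.
rewrite cobd_join ?D2A //.
have E : (-1) ^+ #|s| * (-1) ^+ #|s| = 1 :> K by rewrite -expr2 sqrr_sign.
by rewrite -[RHS]mul1r -[X in _ = X * _]E; ring.
Qed.
End Homotopies.

(** One half of the Kunneth formula. The homotopy of the first factor moves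
    a cocycle to faces with at most [h1] vertices in [A]. As [d > h1 + h2],
    they have more than [h2] vertices outside [A], and the homotopy of the
    second factor turns the cocycle into a coboundary. *)
Lemma join_acyclic h1 h2 d :
  (forall i, (h1 < i)%N -> ~ cohom_nz e D1 i) ->
  (forall i, (h2 < i)%N -> ~ cohom_nz e D2 i) ->
  (h1 + h2 < d)%N -> ~ cohom_nz join_sgn D d.
Proof.
move=> /(contraction dD1 s1) [S1 [S1s S1h]] /(contraction dD2 s2) [S2 [S2s S2h]] hd.
case=> z [zc nb]; apply: nb.
(* [z] moved off the faces with more than [h1] vertices in [A]; it is cut to the
   faces with [d] vertices so that it vanishes there on all sets. *)
pose z1 u := if D u && (#|u| == d) then z u - cobd join_sgn (homotopy_l S1 z) u else 0.
have card_sD u a : a \in u -> #|u| = d.+1 -> #|u :\ a| = d.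
  by rewrite (cardsD1 a) => ->; rewrite add1n => -[].
have z1c u : D u -> #|u| = d.+1 -> cobd join_sgn z1 u = 0.
  move=> Du ud; transitivity (cobd join_sgn (fun u => z u - cobd join_sgn (homotopy_l S1 z) u) u).
    apply: eq_cobd => a ua; rewrite /z1 (card_sD u a) // eqxx.
    by rewrite (join_down _ Du) // subD1set.
  by rewrite cobdB zc // (cobd_cobd _ join_signs Du) subrr.
have z10 u : (h1 < #|u :&: A|)%N -> z1 u = 0.
  rewrite /z1; case: ifP => // /andP[Du /eqP ud] hu.
  move: (Du); rewrite DE => /andP[Ds Dt].
  have := homotopy_lE S1s z Ds Dt; rewrite -join_decomp S1h // big1 ?addr0.
    by rewrite -join_decomp => ->; rewrite subrr.
  move=> s _; have [->|/S1s [Ds' cs]] := eqVneq (S1 s (u :&: A)) 0; first by rewrite mul0r.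
  rewrite zc ?mulr0 //; first exact: joinDE.
  by rewrite join_card ?D1A ?D2A // cs addSn -join_card ?D1A ?D2A // -join_decomp ud.
exists (fun u => homotopy_l S1 z u + homotopy_r S2 z1 u) => u Du ud; rewrite cobdD.
suff -> : cobd join_sgn (homotopy_r S2 z1) u = z1 u.
  by rewrite /z1 Du ud eqxx addrC subrK.
move: (Du); rewrite DE => /andP[Ds Dt].
have := homotopy_rE S2s z1 Ds Dt; rewrite -join_decomp.
rewrite [X in _ * X]big1 ?mulr0 ?addr0; last first.
  move=> t _; have [->|/S2s [Dt' ct]] := eqVneq (S2 t (u :\: A)) 0; first by rewrite mul0r.
  rewrite z1c ?mulr0 //; first exact: joinDE.
  by rewrite join_card ?D1A ?D2A // ct addnS -join_card ?D1A ?D2A // -join_decomp ud.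
move=> ->; case: (ltnP h2 #|u :\: A|) => [h2t|t2h].
  by rewrite S2h // -join_decomp.
have uc : #|u| = (#|u :&: A| + #|u :\: A|)%N by rewrite cardsID.
have h1s : (h1 < #|u :&: A|)%N.
  by move: hd; rewrite -ud uc; move: t2h; lia.
have z10' t : z1 ((u :&: A) :|: t) = 0.
  apply: z10; apply: leq_trans h1s _; apply: subset_leq_card.
  by rewrite setIUl -setIA setIid subsetUl.
rewrite (z10 u) // big1 ?add0r.
  rewrite [LHS]big1 // => a _; rewrite big1 ?mulr0 // => t _.
  by rewrite z10' mulr0.
by move=> t _; rewrite /cobd big1 ?mulr0 // => a _; rewrite z10' mulr0.
Qed.

(** The other half: the product of two cocycles pairs to 1 with the product
    of their dual cycles, and this product kills coboundaries. *)
Lemma join_cohom_nz d1 d2 : cohom_nz e D1 d1 -> cohom_nz e D2 d2 ->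
  cohom_nz join_sgn D (d1 + d2).
Proof.
move=> /(dual_cycle) [z1 [w1 [z1c w1s w1b wz1]]].
move=> /(dual_cycle) [z2 [w2 [z2c w2s w2b wz2]]].
(* The values of [z1] off degree [d1] are arbitrary, so they must be cut away. *)
pose z u := if #|u :&: A| == d1 then z1 (u :&: A) * z2 (u :\: A) else 0.
have sub1 (r B : {set V}) a : r \subset B -> r :\ a \subset B.
  exact: subset_trans (subD1set _ _).
exists z; split=> [u Du|[y yE]].
  have := Du; rewrite DE => /andP[Ds Dt].
  set s := u :&: A in Ds *; set t := u :\: A in Dt *.
  have [sA tA] : s \subset A /\ t \subset ~: A by rewrite D1A ?D2A.
  have -> : u = s :|: t by apply: join_decomp.
  rewrite join_card // => ud; rewrite cobd_join //.
  have -> : cobd e (fun s' => z (s' :|: t)) s = 0.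
    have [sd|sd] := eqVneq #|s| d1.+1.
      rewrite (@eq_cobd _ _ e _ (fun r => z2 t * z1 r) s) ?cobdZ ?z1c ?mulr0 //.
      move=> a sa; rewrite /z joinI ?joinD ?sub1 //.
      by move: sd; rewrite (cardsD1 a) sa add1n => -[->]; rewrite eqxx mulrC.
    apply: big1 => a sa; rewrite /z joinI ?sub1 // ifN ?mulr0 //.
    by apply: contraNneq sd => <-; rewrite (cardsD1 a s) sa.
  rewrite add0r; have [sd|sd] := eqVneq #|s| d1.
    rewrite (@eq_cobd _ _ e _ (fun r => z1 s * z2 r) t).
      rewrite cobdZ z2c ?mulr0 //.
      by apply/eqP; rewrite -(eqn_add2l #|s|) ud sd addnS.
    by move=> a ta; rewrite /z joinI ?joinD ?sub1 // sd eqxx.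
  rewrite [cobd _ _ _]big1 ?mulr0 // => a ta; rewrite /z joinI ?joinD ?sub1 //.
  by rewrite (negPf sd) mulr0.
have : \sum_s \sum_t w1 s * w2 t * z (s :|: t) = 1.
  rewrite -wz1; apply: eq_bigr => s _.
  have [->|/w1s [Ds sd]] := eqVneq (w1 s) 0.
    by rewrite mul0r big1 // => t _; rewrite !mul0r.
  rewrite -[RHS]mulr1 -wz2 mulr_sumr; apply: eq_bigr => t _.
  have [->|/w2s [Dt td]] := eqVneq (w2 t) 0; first by rewrite mulr0 !mul0r mulr0.
  by rewrite /z joinI ?joinD ?D1A ?D2A // sd eqxx; ring.
suff -> : \sum_s \sum_t w1 s * w2 t * z (s :|: t) = 0.
  by move/eqP; rewrite eq_sym oner_eq0.
transitivity (\sum_s \sum_t (w2 t * (w1 s * cobd e (fun r => y (r :|: t)) s)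
   + (-1) ^+ d1 * w1 s * (w2 t * cobd e (fun r => y (s :|: r)) t))).
  apply: eq_bigr => s _; apply: eq_bigr => t _.
  have [->|/w1s [Ds sd]] := eqVneq (w1 s) 0; first by ring.
  have [->|/w2s [Dt td]] := eqVneq (w2 t) 0; first by ring.
  have [sA tA] : s \subset A /\ t \subset ~: A by rewrite D1A ?D2A.
  rewrite -yE ?joinDE ?join_card ?sd ?td // cobd_join // sd; ring.
under eq_bigr do rewrite big_split /= -mulr_sumr w2b mulr0 addr0.
rewrite exchange_big big1 // => t _ /=.
by rewrite -mulr_sumr w1b mulr0.
Qed.
End Join.

(** * Independence complexes of graphs *)

Section Independence.
Variables (K : fieldType) (G : sgraph).
Implicit Types (s t W C : {set G}) (x y : G).

Definition indep s := [forall x in s, forall y in s, ~~ adj x y].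
Definition ind_on W : pred {set G} := fun s => (s \subset W) && indep s.
Definition ind_nz W d := cohom_nz (@order_sgn K G) (ind_on W) d.
Definition closed_nbhd x := [set y | (y == x) || adj x y].

Lemma indepP s : reflect {in s &, forall x y, ~~ adj x y} (indep s).
Proof.
apply: (iffP forall_inP) => [h x y xs ys|h x xs]; first by have /forall_inP := h x xs; apply.
by apply/forall_inP=> y ys; apply: h.
Qed.

Lemma indepS s t : s \subset t -> indep t -> indep s.
Proof. by move=> /subsetP st /indepP h; apply/indepP => x y /st xt /st yt; apply: h. Qed.

Lemma indepU1 x s : indep (x |: s) = indep s && [forall y in s, ~~ adj x y].
Proof.
apply/idP/andP=> [h|[/indepP h /forall_inP hx]].
  split; first by apply: indepS h; apply: subsetUr.
  by apply/forall_inP=> y ys; move/indepP: h; apply; rewrite !inE ?eqxx ?ys ?orbT.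
apply/indepP=> a b; rewrite !inE => /orP[/eqP->|sa] /orP[/eqP->|sb].
- by rewrite adj_irr.
- exact: hx.
- by rewrite adj_sym hx.
exact: h.
Qed.

Lemma ind_on_down W : down_closed (ind_on W).
Proof.
move=> s t st /andP[tW ti]; rewrite /ind_on (subset_trans st tW).
exact: indepS ti.
Qed.

Lemma ind_nz_size W d : ind_nz W d -> (d <= #|W|)%N.
Proof. by case/cohom_nz_size => s /andP[/subset_leq_card h _] <-. Qed.

(** The link of [x] consists of the independent sets that avoid the closed
    neighbourhood of [x]. *)
Lemma ind_nz_del_link W x d : x \in W -> ind_nz W d.+1 ->
  ind_nz (W :\ x) d.+1 \/ ind_nz (W :\: closed_nbhd x) d.
Proof.
move=> xW /(cohom_del_link x (@ind_on_down W) (@order_sgn_signs _ _ _)) [] h; [left|right].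
  apply: eq_cohom_nz h => s /=; rewrite /ind_on subsetD1 andbAC.
  by case: (s \subset W); rewrite //= andbC.
apply: eq_cohom_nz h => s /=; rewrite /ind_on indepU1 subUset sub1set xW /=.
have -> : (s \subset W :\: closed_nbhd x) =
    [&& s \subset W, x \notin s & [forall y in s, ~~ adj x y]].
  apply/subsetP/and3P=> [h|[/subsetP sW xs /forall_inP hx] y ys].
    split; first by apply/subsetP=> y /h; rewrite inE => /andP[].
      by apply/negP=> /h; rewrite !inE eqxx.
    by apply/forall_inP=> y /h; rewrite !inE negb_or => /andP[/andP[]].
  rewrite !inE sW // negb_or hx // !andbT; by apply: contraNneq xs => <-.
by rewrite -!andbA; do !bool_congr.
Qed.

(** A vertex without neighbours in [W] is the apex of a cone. *)
Lemma ind_nz_cone W x d : x \in W -> (forall y, y \in W -> ~~ adj x y) -> ~ ind_nz W d.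
Proof.
move=> xW hx; apply: (@cone_acyclic _ _ _ _ x); first exact: order_sgn_signs.
move=> s /andP[sW si]; rewrite /ind_on subUset sub1set xW sW indepU1 si /=.
by apply/forall_inP=> y ys; apply/hx/(subsetP sW).
Qed.

Lemma ind_nz_set0 : ind_nz set0 0.
Proof.
apply: cohom_nz_empty; last by move=> t /andP[]; rewrite subset0 => /eqP->; rewrite cards0.
by rewrite /ind_on sub0set; apply/indepP=> x y; rewrite inE.
Qed.

Lemma indep1 x : indep [set x].
Proof. by apply/indepP=> a b; rewrite !inE => /eqP-> /eqP->; rewrite adj_irr. Qed.

(** The complex consists of two isolated points. *)
Lemma ind_nz_edge x y : adj x y -> ind_nz [set x; y] 1.
Proof.
move=> xy; have nxy : x != y by apply: contraTneq xy => ->; rewrite adj_irr.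
apply: (@cohom_two_points _ _ _ _ x y) => //; first exact: order_sgn_signs.
- by rewrite /ind_on sub1set !inE eqxx indep1.
- by rewrite /ind_on sub1set !inE eqxx orbT indep1.
move=> t /andP[txy /indepP ti] t2.
have tE : t = [set x; y] by apply/eqP; rewrite eqEcard txy t2 cards2 nxy.
by have := ti x y; rewrite tE !inE !eqxx orbT xy => /(_ isT isT).
Qed.

Section Disjoint.
Variables W1 W2 : {set G}.
Hypothesis dis : forall x y, x \in W1 -> y \in W2 -> x != y /\ ~~ adj x y.

Let W1C : W2 \subset ~: W1.
Proof.
by apply/subsetP=> y yW; rewrite inE; apply/negP=> /dis /(_ yW) []; rewrite eqxx.
Qed.

Let ind_joinE u : ind_on (W1 :|: W2) u = ind_on W1 (u :&: W1) && ind_on W2 (u :\: W1).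
Proof.
rewrite /ind_on subsetIr subDset /=; apply/andP/andP=> [[uW h]|[h1 /andP[uW h2]]].
  by rewrite uW; split; apply: indepS h; rewrite ?subsetIl ?subsetDl.
split=> //; move/indepP: h1 => h1; move/indepP: h2 => h2; apply/indepP=> x y xu yu.
have uW2 z : z \in u -> z \notin W1 -> z \in W2.
  by move=> zu zW; have := subsetP uW _ zu; rewrite inE (negPf zW).
case: (boolP (x \in W1)) => xW; case: (boolP (y \in W1)) => yW.
- by apply: h1; rewrite inE ?xu ?yu.
- by have [] := dis xW (uW2 _ yu yW).
- by rewrite adj_sym; have [] := dis yW (uW2 _ xu xW).
by apply: h2; rewrite inE ?xu ?yu ?xW ?yW.
Qed.

Let D1W s : ind_on W1 s -> s \subset W1. Proof. by case/andP. Qed.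
Let D2W s : ind_on W2 s -> s \subset ~: W1.
Proof. by case/andP => /subset_trans h _; apply: h. Qed.

(** Without edges between [W1] and [W2] the independence complex of the
    union is a join. *)
Lemma ind_nz_union_le h1 h2 d :
  (forall i, ind_nz W1 i -> (i <= h1)%N) -> (forall i, ind_nz W2 i -> (i <= h2)%N) ->
  ind_nz (W1 :|: W2) d -> (d <= h1 + h2)%N.
Proof.
move=> H1 H2 nz; rewrite leqNgt; apply/negP=> hd.
have J := join_acyclic (@ind_on_down W1) (@ind_on_down W2) D1W D2W ind_joinE
  (@order_sgn_signs K _ _) (@order_sgn_signs K _ _) _ _ hd.
apply: (J) => [i h1i /H1|i h2i /H2|]; try by rewrite leqNgt ?h1i ?h2i.
apply: cohom_nz_sign nz; [exact: ind_on_down | exact: order_sgn_signs |].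
by apply: (join_signs ind_joinE); apply: order_sgn_signs.
Qed.

Lemma ind_nz_union d1 d2 : ind_nz W1 d1 -> ind_nz W2 d2 -> ind_nz (W1 :|: W2) (d1 + d2).
Proof.
move=> n1 n2; have := join_cohom_nz D1W D2W ind_joinE n1 n2.
apply: cohom_nz_sign; [exact: ind_on_down | | exact: order_sgn_signs].
by apply: (join_signs ind_joinE); apply: order_sgn_signs.
Qed.
End Disjoint.

(** Each vertex of the cover [C] is deleted or replaced by its link, and
    only the latter lowers the degree, by one. At the end no edge is left,
    and such a set is a cone unless it is empty. *)
Lemma ind_nz_cover W C d : indep (W :\: C) -> ind_nz W d -> (d <= #|W :&: C|)%N.
Proof.
have [n] := ubnP #|W :&: C|; elim: n W d => // n IH W d Wn WC nz.
have [W0|[x]] := set_0Vmem (W :&: C).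
  have WE : W :\: C = W by apply/setDidPl; rewrite -setI_eq0 W0.
  rewrite WE in WC; have [Wz|[x xW]] := set_0Vmem W.
    by rewrite W0 cards0 -(cards0 G) -Wz; apply: ind_nz_size nz.
  case: (ind_nz_cone xW _ nz) => y yW.
  by move/indepP: WC; apply.
rewrite inE => /andP[xW xC]; case: d nz => // d nz.
have WCx : #|W :&: C| = #|(W :\ x) :&: C|.+1.
  by rewrite (cardsD1 x) inE xW xC add1n setIDAC.
have [] := ind_nz_del_link xW nz => {}nz.
  rewrite WCx; apply: leq_trans (IH _ _ _ _ nz) _ => //; first by rewrite -ltnS -WCx.
  by apply: indepS WC; apply/setSD/subD1set.
have sub : W :\: closed_nbhd x \subset W :\ x.
  by apply/subsetP=> y; rewrite !inE negb_or => /andP[/andP[-> _] ->].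
have le : (#|(W :\: closed_nbhd x) :&: C| <= #|(W :\ x) :&: C|)%N.
  by apply/subset_leq_card/setSI.
rewrite WCx ltnS; apply: (leq_trans _ le); apply: IH nz.
  by apply: (leq_ltn_trans le); rewrite -ltnS -WCx.
by apply: indepS WC; apply/setSD/subsetDl.
Qed.

(** The combinatorial form of the regularity; see [reg_edge_ideal]. *)
Definition ind_reg r :=
  (exists W, ind_nz W r) /\ forall W d, ind_nz W d -> (d <= r)%N.

Lemma ind_reg_exists : exists r, ind_reg r.
Proof.
have [|k [[W [d [nz kE]]] kmin]] :=
    @ex_least (fun k => exists W d, ind_nz W d /\ k = (#|G| - d)%N).
  by exists (#|G| - 0)%N, set0, 0%N; split=> //; apply: ind_nz_set0.
exists d; split=> [|W' d' nz']; first by exists W.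
rewrite leqNgt; apply/negP=> dd; apply: (kmin (#|G| - d')%N); last by exists W', d'.
by rewrite kE; have := leq_trans (ind_nz_size nz') (max_card _); lia.
Qed.
End Independence.

Section IndEmbed.
Variables (K : fieldType) (G G' : sgraph) (f : G -> G').
Hypotheses (f_inj : injective f) (f_adj : forall x y, adj (f x) (f y) = adj x y).

Lemma indep_imset (s : {set G}) : indep (f @: s) = indep s.
Proof.
apply/indepP/indepP => h x y.
  by move=> xs ys; rewrite -f_adj; apply: h; apply: imset_f.
by move=> /imsetP[a sa ->] /imsetP[b sb ->]; rewrite f_adj h.
Qed.

Lemma ind_nz_imset (W : {set G}) d : ind_nz K (f @: W) d <-> ind_nz K W d.
Proof.
have DE (s : {set G}) : ind_on (f @: W) (f @: s) = ind_on W s.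
  rewrite /ind_on indep_imset; congr (_ && _).
  by apply/subsetP/subsetP => h x; [rewrite -!(mem_imset _ _ f_inj); apply: h
    | case/imsetP=> a sa ->; rewrite mem_imset ?h].
have Dim t : ind_on (f @: W) t -> exists s : {set G}, t = f @: s.
  move=> /andP[tW _]; exists (f @^-1: t).
  apply/setP=> x; apply/idP/imsetP=> [xt|[a]]; last by rewrite inE => h ->.
  by have /imsetP[a aW xE] := subsetP tW _ xt; exists a; rewrite // inE -xE.
have [to from] := cohom_nz_imset f_inj (@order_sgn K G') d DE Dim.
have sf := signs_imset f_inj DE (@order_sgn_signs K G' (ind_on (f @: W))).
split=> [/to h|nz].
  by apply: cohom_nz_sign h; [exact: ind_on_down | exact: sf | exact: order_sgn_signs].
apply: from; apply: cohom_nz_sign nz; [exact: ind_on_down | exact: order_sgn_signs | exact: sf].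
Qed.
End IndEmbed.

(** * Coronas *)

Section CoronaReg.
Variables (K : fieldType) (X H : sgraph).
Local Notation G := (corona X H).
Implicit Types (W : {set G}) (B : {set X}).

Definition base (g : G) : X := match g with inl x => x | inr (x, _) => x end.
Definition copy (x : X) (h : H) : G := inr (x, h).

Lemma copy_inj x : injective (copy x).
Proof. by move=> h k []. Qed.

Lemma copy_adj x h k : adj (copy x h) (copy x k) = adj h k.
Proof. by rewrite /= eqxx. Qed.

(** Copies of [H] over different base vertices have no edge between them, so
    that their contributions add. *)
Lemma ind_nz_copies_le r B W d : (forall (U : {set H}) i, ind_nz K U i -> (i <= r)%N) ->
  (forall x, inl x \notin W) -> (forall g, g \in W -> base g \in B) ->
  ind_nz K W d -> (d <= #|B| * r)%N.
Proof.
move=> Hr; have [n] := ubnP #|B|; elim: n B W d => // n IH B W d Bn Winl WB nz.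
have [B0|[x xB]] := set_0Vmem B.
  have W0 : W = set0.
    by apply/setP=> g; rewrite inE; apply/negP=> /WB; rewrite B0 inE.
  by have := ind_nz_size nz; rewrite W0 cards0 leqn0 => /eqP->.
(* The copy of [H] over [x] is split off from the others. *)
pose A := [set g : G | base g == x].
move: nz; rewrite -(setID W A) => /(@ind_nz_union_le K G _ _ _ r (#|B :\ x| * r)).
rewrite (cardsD1 x B) xB mulSn; apply.
- move=> g g'; rewrite !inE => /andP[gW /eqP gx] /andP[gx' gW']; split.
    by apply: contraNneq gx' => <-; apply/eqP.
  move: gW gW' gx gx'; case: g => [y|[y h]]; case: g' => [y'|[y' h']] //=.
  + by move=> yW; have := Winl y; rewrite yW.
  + by move=> yW; have := Winl y; rewrite yW.
  + by move=> _ yW; have := Winl y'; rewrite yW.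
  by move=> _ _ ->; rewrite eq_sym => /negPf ->.
- move=> i; have -> : W :&: A = copy x @: (copy x @^-1: W).
    apply/setP=> g; rewrite !inE; apply/andP/imsetP.
      case: g => [y|[y h]] /= [gW /eqP yx]; first by have := Winl y; rewrite gW.
      by exists h; rewrite ?inE -?yx.
    by case=> h; rewrite inE => hW ->.
  by move/(ind_nz_imset K (@copy_inj x) (@copy_adj x)); apply: Hr.
move=> i; apply: IH.
- by move: Bn; rewrite (cardsD1 x B) xB.
- by move=> y; rewrite inE (negPf (Winl y)) andbF.
by move=> g; rewrite !inE => /andP[gx /WB ->]; rewrite gx.
Qed.

(** Passing to the link of a base vertex costs one degree, but also frees
    the [r] degrees granted to its copy of [H]. *)
Lemma ind_nz_corona_le r B W d : (0 < r)%N ->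
  (forall (U : {set H}) i, ind_nz K U i -> (i <= r)%N) ->
  (forall g, g \in W -> base g \in B) -> ind_nz K W d -> (d <= #|B| * r)%N.
Proof.
move=> r0 Hr; have [n] := ubnP #|W|; elim: n B W d => // n IH B W d Wn WB nz.
case: (classic (exists x, inl x \in W)) => [[x xW]|no]; last first.
  by apply: ind_nz_copies_le nz => // x; apply/negP=> xW; apply: no; exists x.
case: d nz => // d nz.
have [] := ind_nz_del_link xW nz => {}nz.
  apply: IH nz; first by move: Wn; rewrite (cardsD1 (inl x) W) xW.
  by move=> g; rewrite !inE => /andP[_ /WB].
have xB : x \in B by apply: (WB (inl x)).
rewrite (cardsD1 x B) xB mulSn; suff : (d <= #|B :\ x| * r)%N by move: r0; lia.
apply: IH nz.
  suff : (#|W :\: closed_nbhd (inl x : G)| < #|W|)%N by move: Wn; lia.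
  apply: proper_card; rewrite properE subsetDl; apply/subsetPn; exists (inl x) => //.
  by rewrite !inE eqxx.
move=> g; rewrite !inE negb_or => /andP[/andP[gx nadj] gW].
rewrite WB // andbT; move: gx nadj gW; case: g => [y|[y h]] /=.
  by move=> gx _ _; apply: contraNneq gx => ->.
by move=> _ + _; rewrite eq_sym.
Qed.

Lemma ind_nz_copies B (W0 : {set H}) r : ind_nz K W0 r ->
  ind_nz K [set g : G | if g is inr (x, h) then (x \in B) && (h \in W0) else false]
    (#|B| * r).
Proof.
move=> nz0; have [n] := ubnP #|B|; elim: n B => // n IH B Bn.
have [->|[x xB]] := set_0Vmem B.
  rewrite cards0 mul0n; set W := [set _ | _].
  suff -> : W = set0 by apply: ind_nz_set0.
  by apply/setP=> -[y|[y h]]; rewrite !inE.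
have /IH nzB : (#|B :\ x| < n)%N by move: Bn; rewrite (cardsD1 x B) xB.
have nzx : ind_nz K (copy x @: W0) r.
  by apply/(ind_nz_imset K (@copy_inj x) (@copy_adj x)).
have := ind_nz_union _ nzx nzB; rewrite (cardsD1 x B) xB mulSn => nzU.
set W := [set _ | _].
match type of nzU with _ -> ind_nz K ?W' _ => have -> : W = W' end.
  apply/setP=> g; rewrite !inE; apply/idP/orP.
    case: g => // -[y h] /andP[yB hW]; case: (eqVneq y x) => [->|yx].
      by left; apply: imset_f.
    by right; rewrite !inE yx yB.
  case=> [/imsetP[h hW ->] /=|]; first by rewrite xB.
  by case: g => // -[y h]; rewrite !inE => /andP[/andP[_ ->] ->].
apply: nzU => g g' /imsetP[h hW ->]; rewrite inE; case: g' => // -[y k].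
rewrite !inE => /andP[/andP[yx yB] kW] /=; split; last by rewrite eq_sym (negPf yx).
by apply: contraNneq yx => -[->].
Qed.

(** The base graph enters by its number of vertices only: a copy of [H]
    contributes at least as much as the vertex it is attached to. *)
Lemma ind_reg_corona r : ~~ null_graph H -> ind_reg K H r -> ind_reg K G (#|X| * r).
Proof.
move=> nH [[W0 nz0] Hr].
have r0 : (0 < r)%N.
  move: nH; rewrite negb_forall => /existsP[x]; rewrite negb_forall => /existsP[y].
  by rewrite negbK => xy; apply: Hr (ind_nz_edge K xy).
split.
  rewrite -cardsT; eexists; apply: (ind_nz_copies setT nz0).
move=> W d; rewrite -cardsT; apply: ind_nz_corona_le => // g _; exact: in_setT.
Qed.

(** The edges from the vertices of [B] to their leaves over [h] form an
    induced matching. *)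
Lemma ind_nz_matching (h : H) B : indep B ->
  ind_nz K
    [set g : G | match g with
                 | inl x => x \in B
                 | inr (x, k) => (x \in B) && (k == h)
                 end] #|B|.
Proof.
have [n] := ubnP #|B|; elim: n B => // n IH B Bn iB.
have [->|[x xB]] := set_0Vmem B.
  rewrite cards0; set W := [set _ | _].
  suff -> : W = set0 by apply: ind_nz_set0.
  by apply/setP=> -[y|[y k]]; rewrite !inE.
have [ltB iB'] : (#|B :\ x| < n)%N /\ indep (B :\ x).
  split; first by move: Bn; rewrite (cardsD1 x B) xB.
  by apply: indepS iB; apply: subD1set.
have nzB := IH _ ltB iB'.
have nzx : ind_nz K [set (inl x : G); (inr (x, h) : G)] 1.
  by apply: ind_nz_edge; rewrite /= eqxx.
have := ind_nz_union _ nzx nzB; rewrite (cardsD1 x B) xB => nzU.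
set W := [set _ | _].
match type of nzU with _ -> ind_nz K ?W' _ => suff -> : W = W' end.
  apply: nzU => g g'; rewrite !inE => /orP[] /eqP->.
    case: g' => [y|[y k]]; rewrite !inE.
      move=> /andP[yx yB]; split; first by apply: contraNneq yx => -[->].
      by move/indepP: iB; apply.
    by move=> /andP[/andP[yx _] _]; split=> //=; rewrite eq_sym.
  case: g' => [y|[y k]]; rewrite !inE.
    by move=> /andP[yx _]; split=> //=; rewrite eq_sym.
  move=> /andP[/andP[yx _] _]; split; last by rewrite /= eq_sym (negPf yx).
  by apply: contraNneq yx => -[->].
apply/setP=> g; case: g => [y|[y k]]; rewrite !inE.
  have -> : (inl y == inl x :> G) = (y == x) by apply/eqP/eqP=> [[]|->].
  by rewrite orbF; case: eqVneq => [->|]; rewrite ?xB.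
have -> : (inr (y, k) == inr (x, h) :> G) = (y == x) && (k == h).
  by apply/eqP/andP=> [[-> ->]|[/eqP-> /eqP->]].
by case: (eqVneq y x) => [->|_]; rewrite ?xB /= ?orbF ?orFb.
Qed.
End CoronaReg.

Section NullCorona.
Variables (K : fieldType) (u v : nat) (H : sgraph).
Hypotheses (nullH : null_graph H) (h : H).
Local Notation X := (biclique u v).
Local Notation G := (corona X H).
Implicit Types (W : {set G}).

Definition lside : {set X} := [set inl i | i : 'I_u].
Definition rside : {set X} := [set inr j | j : 'I_v].

Lemma card_lside : #|lside| = u.
Proof. by rewrite card_imset ?card_ord // => i j []. Qed.

Lemma card_rside : #|rside| = v.
Proof. by rewrite card_imset ?card_ord // => i j []. Qed.

Lemma indep_lside : indep lside.
Proof. by apply/indepP => _ _ /imsetP[i _ ->] /imsetP[j _ ->]. Qed.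

Lemma indep_rside : indep rside.
Proof. by apply/indepP => _ _ /imsetP[i _ ->] /imsetP[j _ ->]. Qed.

Definition base_of (B : {set X}) : {set G} := [set inl x | x in B].

Lemma card_base_of B : #|base_of B| = #|B|.
Proof. by rewrite card_imset // => i j []. Qed.

Lemma indep_off_side W (B C : {set X}) : (forall x, (x \in B) || (x \in C)) ->
  W :&: base_of C = set0 -> indep (W :\: base_of B).
Proof.
move=> BC WC; apply/indepP=> g g'.
have noinl x : inl x \in W :\: base_of B -> False.
  rewrite inE => /andP[xB xW]; case/orP: (BC x) => xs.
    by case/negP: xB; apply: imset_f.
  have : inl x \in W :&: base_of C by rewrite inE xW; apply: imset_f.
  by rewrite WC inE.
case: g => [x /noinl|[x k] _] //; case: g' => [y /noinl|[y l] _] //=.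
by rewrite negb_and (forallP (forallP nullH k) l) orbT.
Qed.

Lemma sides_cover (x : X) : (x \in lside) || (x \in rside).
Proof. by case: x => i; apply/orP; [left|right]; apply: imset_f. Qed.

Lemma ind_nz_side W (B C : {set X}) d : (forall x, (x \in B) || (x \in C)) ->
  W :&: base_of C = set0 -> ind_nz K W d -> (d <= #|W :&: base_of B|)%N.
Proof. by move=> BC WC; apply: ind_nz_cover; apply: indep_off_side BC WC. Qed.

(** Left vertices are removed as long as [W] meets both sides. The link of a
    left vertex has no right vertex, and is covered by the other left
    vertices, which are at most [u - 1]. *)
Lemma ind_nz_null_corona W d : ind_nz K W d -> (d <= maxn u v)%N.
Proof.
have szl : #|base_of lside| = u by rewrite card_base_of card_lside.
have [n] := ubnP #|W :&: base_of lside|; elim: n W d => // n IH W d Wn nz.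
have [W0|[g]] := set_0Vmem (W :&: base_of lside).
  have rl x : (x \in rside) || (x \in lside) by rewrite orbC sides_cover.
  apply: leq_trans (ind_nz_side rl W0 nz) _; apply: leq_trans (leq_maxr u v).
  by apply: leq_trans (subset_leq_card (subsetIr _ _)) _; rewrite card_base_of card_rside.
rewrite inE => /andP[gW gL]; case: d nz => // d nz.
have [] := ind_nz_del_link gW nz => {}nz.
  apply: IH nz; move: Wn; rewrite (cardsD1 g) inE gW gL add1n ltnS.
  by rewrite setIDAC.
apply: leq_trans (leq_maxl u v); rewrite -[leqRHS]szl (cardsD1 g) gL add1n ltnS.
case/imsetP: gL => x /imsetP[i _ xE] gE.
have WR : (W :\: closed_nbhd g) :&: base_of rside = set0.
  apply/setP=> g'; rewrite in_set0; apply/negP.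
  rewrite inE => /andP[+ /imsetP[y /imsetP[j _ yE] g'E]].
  by rewrite g'E yE gE xE !inE /= ?orbT.
apply: leq_trans (ind_nz_side sides_cover WR nz) _; apply: subset_leq_card.
by apply/subsetP=> g'; rewrite !inE negb_or => /andP[/andP[/andP[-> _] _] ->].
Qed.

Lemma ind_reg_null_corona : ind_reg K G (maxn u v).
Proof.
split; last exact: ind_nz_null_corona.
have := ind_nz_matching K h indep_lside; have := ind_nz_matching K h indep_rside.
rewrite card_lside card_rside => nr nl.
by case: (leqP u v) => _; eexists; [exact: nr | exact: nl].
Qed.
End NullCorona.

Lemma ind_reg_biclique_corona (K : fieldType) u v (H : sgraph) r :
  (0 < #|H|)%N -> ind_reg K H r ->
  ind_reg K (corona (biclique u v) H) (if null_graph H then maxn u v else (u + v) * r)%N.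
Proof.
move=> /card_gt0P[h _] rH; case: ifP => [nH|/negbT nH].
  exact: ind_reg_null_corona.
have := @ind_reg_corona K (biclique u v) H r nH rH.
by rewrite /= card_sum !card_ord.
Qed.

(** * Graded free modules and Koszul chains *)

Section Graded.
Variables (K : fieldType) (n : nat).
Local Notation S := {mpoly K[n]}.
Implicit Types (p q : S) (m : 'X_{1..n}) (a b c d : nat).

(** In this form the case [a < b] is no exception: it leaves no monomial. *)
Lemma homog_diffP a b p :
  reflect (forall m, p@_m != 0 -> (mdeg m + b)%N = a) (homog_diff a b p).
Proof.
rewrite /homog_diff; case: leqP => ba.
  apply: (iffP (dhomogP _ _ _)) => h m.
    by rewrite -mcoeff_msupp => /h ->; rewrite subnK.
  by rewrite mcoeff_msupp => /h <-; rewrite addnK.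
apply: (iffP eqP) => [-> m|h]; first by rewrite mcoeff0 eqxx.
apply/mpolyP=> m; rewrite mcoeff0; apply: contraTeq ba => /h <-.
by rewrite -leqNgt leq_addl.
Qed.

Lemma homog_diff0 a b : homog_diff a b (0 : S).
Proof. by apply/homog_diffP => m; rewrite mcoeff0 eqxx. Qed.

Lemma homog_diffD a b p q : homog_diff a b p -> homog_diff a b q -> homog_diff a b (p + q).
Proof.
move=> /homog_diffP hp /homog_diffP hq; apply/homog_diffP => m; rewrite mcoeffD.
by have [->|/hp //] := eqVneq p@_m 0; rewrite add0r => /hq.
Qed.

Lemma homog_diffB a b p q : homog_diff a b p -> homog_diff a b q -> homog_diff a b (p - q).
Proof.
move=> hp /homog_diffP hq; apply: homog_diffD hp _; apply/homog_diffP => m.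
by rewrite mcoeffN oppr_eq0 => /hq.
Qed.

Lemma homog_diff_sum (I : Type) (r : seq I) (P : pred I) (F : I -> S) a b :
  (forall i, P i -> homog_diff a b (F i)) -> homog_diff a b (\sum_(i <- r | P i) F i).
Proof.
move=> h; elim/big_rec: _ => [|i p Pi]; first exact: homog_diff0.
by apply: homog_diffD; apply: h.
Qed.

Lemma homog_diffM a b c p q :
  homog_diff a b p -> homog_diff b c q -> homog_diff a c (p * q).
Proof.
move=> /homog_diffP hp /homog_diffP hq; apply/homog_diffP => m.
rewrite -mcoeff_msupp => /msuppM_le /allpairsP [[m1 m2] /= [m1p m2q ->]].
rewrite mcoeff_msupp in m1p; rewrite mcoeff_msupp in m2q.
by rewrite mdegD -addnA hq // hp.
Qed.

(** The component in degree [a] of [p], as an element of the free module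
    with one generator in degree [b]. *)
Definition gpart a b p : S := if (b <= a)%N then pihomog mdeg (a - b) p else 0.

Lemma mcoeff_pihomog d p m : (pihomog mdeg d p)@_m = if mdeg m == d then p@_m else 0.
Proof.
rewrite pihomogE raddf_sum /= big_mkcond /=.
have [mp|mp] := boolP (m \in msupp p).
  rewrite (bigD1_seq m) ?msupp_uniq //= big1_seq ?addr0.
    by case: ifP => // _; rewrite mcoeffZ mcoeffX eqxx mulr1.
  by move=> m' /andP[/negPf nm _]; case: ifP => // _; rewrite mcoeffZ mcoeffX nm mulr0.
rewrite (memN_msupp_eq0 mp) if_same big1_seq // => m' /andP[_ m'p].
case: ifP => // _; rewrite mcoeffZ mcoeffX; case: eqVneq => [mm|]; last by rewrite mulr0.
by rewrite -mm m'p in mp.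
Qed.

Lemma mcoeff_gpart a b p m : (gpart a b p)@_m = if (mdeg m + b == a)%N then p@_m else 0.
Proof.
rewrite /gpart; case: leqP => ba; first by rewrite mcoeff_pihomog -(eqn_add2r b) subnK.
rewrite mcoeff0; case: eqP => // E; move: ba; rewrite -E.
by rewrite ltnNge leq_addl.
Qed.

Lemma gpart_homog a b p : homog_diff a b (gpart a b p).
Proof.
by apply/homog_diffP => m; rewrite mcoeff_gpart; case: ifP => [/eqP //|_]; rewrite eqxx.
Qed.

Lemma gpart_id a a' b p : homog_diff a b p -> gpart a' b p = if a == a' then p else 0.
Proof.
move=> /homog_diffP h; apply/mpolyP=> m; rewrite mcoeff_gpart.
have [pm|/h ->] := eqVneq p@_m 0; last by case: eqP; rewrite ?mcoeff0.
by rewrite pm if_same; case: eqP; rewrite ?pm ?mcoeff0.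
Qed.

Lemma gpart_sum (I : Type) (r : seq I) (P : pred I) (F : I -> S) a b :
  gpart a b (\sum_(i <- r | P i) F i) = \sum_(i <- r | P i) gpart a b (F i).
Proof.
apply/mpolyP=> m; rewrite mcoeff_gpart !raddf_sum /=.
case: ifP => h; last by rewrite big1 // => i _; rewrite mcoeff_gpart h.
by apply: eq_bigr => i _; rewrite mcoeff_gpart h.
Qed.

Lemma gpartM a b c p q : homog_diff b c q -> gpart a c (p * q) = gpart a b p * q.
Proof.
move=> hq; rewrite (mpolyE p) mulr_suml !gpart_sum mulr_suml; apply: eq_bigr => m _.
have hX : homog_diff (mdeg m + b) b (p@_m *: 'X_[m] : S).
  apply/homog_diffP => m'; rewrite mcoeffZ mcoeffX; case: (eqVneq m m') => [->//|_].
  by rewrite mulr0 eqxx.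
rewrite (gpart_id _ hX) (gpart_id _ (homog_diffM hX hq)).
by case: eqP; rewrite ?mul0r.
Qed.

Lemma mcoeffXM (i : 'I_n) p m :
  ('X_i * p)@_m = if m i != 0%N then p@_(m - U_(i))%MM else 0.
Proof.
rewrite mulrC; case: ifP => mi.
  by rewrite -[in LHS](submK (m := U_(i)) (m' := m)) ?lep1mP // addmC mcoeffMX.
apply/eqP; rewrite mcoeff_eq0 (perm_mem (msuppMX _ _)); apply/mapP => -[m' _ mE].
by move: mi; rewrite mE mnmDE mnm1E eqxx.
Qed.

Section Rows.
Variable r : nat.
Variable deg : 'I_r -> nat.
Implicit Types (v w : 'rV[S]_r).

Definition homog_row a v := forall k, homog_diff a (deg k) (v 0 k).
Definition gproj a v := \row_k gpart a (deg k) (v 0 k).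

Lemma gproj_hom a v : homog_row a (gproj a v).
Proof. by move=> k; rewrite mxE; apply: gpart_homog. Qed.

Lemma gproj_id a a' v : homog_row a v -> gproj a' v = if a == a' then v else 0.
Proof.
move=> h; apply/rowP=> k; rewrite !mxE (gpart_id _ (h k)).
by case: eqP; rewrite ?mxE.
Qed.

Lemma homog_rowD a v w : homog_row a v -> homog_row a w -> homog_row a (v + w).
Proof. by move=> hv hw k; rewrite mxE; apply: homog_diffD. Qed.

Lemma homog_row_scale a b p v : homog_diff a b p -> homog_row b v -> homog_row a (p *: v).
Proof. by move=> hp hv k; rewrite mxE; apply: homog_diffM hp (hv k). Qed.

Lemma gprojD a v w : gproj a (v + w) = gproj a v + gproj a w.
Proof.
apply/rowP=> k; rewrite !mxE; apply/mpolyP=> m; rewrite mcoeffD !mcoeff_gpart mcoeffD.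
by case: ifP; rewrite ?addr0.
Qed.

Lemma gproj0 a : gproj a 0 = 0.
Proof.
by apply/rowP=> k; rewrite !mxE; apply/mpolyP=> m; rewrite mcoeff_gpart mcoeff0 if_same.
Qed.

Lemma gprojB a v w : gproj a (v - w) = gproj a v - gproj a w.
Proof. by apply/esym/eqP; rewrite subr_eq -gprojD subrK. Qed.

Lemma homog_rowB a v w : homog_row a v -> homog_row a w -> homog_row a (v - w).
Proof. by move=> hv hw k; rewrite !mxE; apply: homog_diffB. Qed.

Lemma gproj_sum v : exists N, v = \sum_(a < N) gproj a v.
Proof.
exists (\max_k (msize (v ord0 k) + deg k)).+1%N; apply/rowP=> k; rewrite summxE.
apply/mpolyP=> m; rewrite raddf_sum /=; under eq_bigr do rewrite mxE mcoeff_gpart.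
have [E|vm] := eqVneq (v ord0 k)@_m 0; first by rewrite E big1 // => i _; rewrite if_same.
have lt : (mdeg m + deg k < (\max_k (msize (v ord0 k) + deg k)).+1)%N.
  rewrite ltnS; apply: leq_trans (leq_bigmax k); rewrite leq_add2r ltnW //.
  by apply: msize_mdeg_lt; rewrite mcoeff_msupp.
rewrite (bigD1 (Ordinal lt)) //= eqxx big1 ?addr0 // => i ni.
by rewrite ifN //; apply: contraNneq ni => E; apply/eqP/val_inj.
Qed.

(** Graded submodules of the free module whose generators have degrees
    [deg]. *)
Record gsub (Z : 'rV[S]_r -> Prop) : Prop := GSub {
  gsub0 : Z 0;
  gsubD : forall v w, Z v -> Z w -> Z (v + w);
  gsubZ : forall p v, Z v -> Z (p *: v);
  gsub_proj : forall a v, Z v -> Z (gproj a v) }.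

Lemma gsub_sum Z : gsub Z -> forall (I : Type) (s : seq I) (P : pred I) F,
  (forall i, P i -> Z (F i)) -> Z (\sum_(i <- s | P i) F i).
Proof.
move=> gZ I s P F h; elim/big_rec: _ => [|i v Pi]; first exact: gsub0.
by apply: gsubD => //; apply: h.
Qed.

Lemma gsubN Z v : gsub Z -> Z v -> Z (- v).
Proof. by move=> gZ Zv; rewrite -scaleN1r; apply: gsubZ. Qed.

Lemma gsubB Z v w : gsub Z -> Z v -> Z w -> Z (v - w).
Proof. by move=> gZ Zv Zw; apply: gsubD => //; apply: gsubN. Qed.
End Rows.

Lemma gproj_mul r r' (deg : 'I_r -> nat) (deg' : 'I_r' -> nat) (phi : 'M[S]_(r', r)) a v :
  (forall k l, homog_diff (deg' k) (deg l) (phi k l)) ->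
  gproj deg a (v *m phi) = gproj deg' a v *m phi.
Proof.
move=> hphi; apply/rowP=> l; rewrite !mxE gpart_sum; apply: eq_bigr => k _.
by rewrite mxE (gpartM _ _ (hphi k l)).
Qed.

Lemma homog_row_mul r r' (deg : 'I_r -> nat) (deg' : 'I_r' -> nat) (phi : 'M[S]_(r', r)) a v :
  (forall k l, homog_diff (deg' k) (deg l) (phi k l)) ->
  homog_row deg' a v -> homog_row deg a (v *m phi).
Proof.
move=> hphi hv l; rewrite mxE; apply: homog_diff_sum => k _.
exact: homog_diffM (hv k) (hphi k l).
Qed.

Implicit Types (A B : {set 'I_n}).
Local Notation e := (@order_sgn K 'I_n).
Definition kcoef (i : 'I_n) (s : {set 'I_n}) : S := e i s *: 'X_i.
(** The differential of the Koszul complex; [c A] is the coefficient of the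
    exterior product of the variables in [A]. *)
Definition kos r (c : {set 'I_n} -> 'rV[S]_r) (B : {set 'I_n}) :=
  \sum_(i | i \notin B) kcoef i B *: c (i |: B).

Lemma kcoef_homog a i s : homog_diff a.+1 a (kcoef i s).
Proof.
apply/homog_diffP => m; rewrite mcoeffZ mcoeffX.
case: (eqVneq _ m) => [<-|_]; last by rewrite mulr0 eqxx.
by rewrite mdeg1.
Qed.

Lemma kos_kos r (c : {set 'I_n} -> 'rV[S]_r) B : kos (kos c) B = 0.
Proof.
have [e1 eN] := @order_sgn_signs K 'I_n predT.
pose F i j := if [&& i \notin B, j \notin B & i != j] then
  (kcoef i B * kcoef j (i |: B)) *: c (j |: (i |: B)) else 0.
transitivity (\sum_i \sum_j F i j).
  rewrite /kos big_mkcond; apply: eq_bigr => i _; case: ifP => iB; last first.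
    by rewrite big1 // => j _; rewrite /F iB.
  rewrite scaler_sumr big_mkcond; apply: eq_bigr => j _.
  by rewrite /F iB !inE negb_or eq_sym andbC; case: ifP; rewrite ?scalerA.
apply: sum_antisym => [i|i j ij]; rewrite /F; first by rewrite eqxx !andbF.
rewrite [j == i]eq_sym ij !andbT andbC; case: ifP => [/andP[jB iB]|_]; last by rewrite oppr0.
rewrite setUCA -scaleNr; congr (_ *: _).
have := eN i j B ij iB jB isT; rewrite /kcoef -!scalerAl -!scalerAr !scalerA => ->.
by rewrite scaleNr mulrC ['X_i * _]mulrC.
Qed.

Lemma kosB r (c c' : {set 'I_n} -> 'rV[S]_r) B :
  kos (fun A => c A - c' A) B = kos c B - kos c' B.
Proof. by rewrite /kos -sumrB; apply: eq_bigr => i _; rewrite scalerBr. Qed.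

Lemma kos_mul r r' (phi : 'M[S]_(r', r)) (c : {set 'I_n} -> 'rV[S]_r') B :
  kos (fun A => c A *m phi) B = kos c B *m phi.
Proof. by rewrite /kos mulmx_suml; apply: eq_bigr => i _; rewrite scalemxAl. Qed.

Lemma kos_hom r (deg : 'I_r -> nat) (c : {set 'I_n} -> 'rV[S]_r) B a :
  (forall A : {set 'I_n}, #|A| = #|B|.+1 -> homog_row deg a (c A)) -> homog_row deg a.+1 (kos c B).
Proof.
move=> hc k; rewrite summxE; apply: homog_diff_sum => i iB.
by apply: (homog_row_scale (kcoef_homog a i B)); apply: hc; rewrite cardsU1 iB.
Qed.

Lemma kos_gsub r (deg : 'I_r -> nat) Z (c : {set 'I_n} -> 'rV[S]_r) B : gsub deg Z ->
  (forall A : {set 'I_n}, #|A| = #|B|.+1 -> Z (c A)) -> Z (kos c B).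
Proof.
move=> gZ hc; rewrite /kos; apply: (gsub_sum gZ) => i iB; apply: (gsubZ gZ).
by apply: hc; rewrite cardsU1 iB.
Qed.

(** Nonvanishing of the Koszul homology of the subquotient [Z/N] in
    homological degree [d] and internal degree [d + a]; this is [Tor_d(Z/N,
    K)]. Subquotients of free modules include both [S/I] and the syzygy
    modules. *)
Definition koszul_nz r (deg : 'I_r -> nat) (Z N : 'rV[S]_r -> Prop) d a :=
  exists c : {set 'I_n} -> 'rV[S]_r,
    [/\ forall A : {set 'I_n}, #|A| = d -> Z (c A) /\ homog_row deg a (c A),
        forall B : {set 'I_n}, #|B|.+1 = d -> N (kos c B) &
        ~ exists b : {set 'I_n} -> 'rV[S]_r,
            (forall A : {set 'I_n}, #|A| = d.+1 -> Z (b A)) /\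
            forall A : {set 'I_n}, #|A| = d -> N (kos b A - c A)].
End Graded.

(** * Multigraded strands of the Koszul complex *)

Lemma setDD1 (T : finType) (W t : {set T}) i :
  i \in W -> W :\: (t :\ i) = i |: (W :\: t).
Proof.
move=> iW; apply/setP=> j; rewrite !inE.
by case: (eqVneq j i) => [->|_]; rewrite ?iW ?andbF.
Qed.

Lemma setDDK (T : finType) (W t : {set T}) : t \subset W -> W :\: (W :\: t) = t.
Proof. by move=> tW; rewrite setDDr setDv set0U; apply/setIidPr. Qed.

Section Strands.
Variables (K : fieldType) (n : nat).
Local Notation S := {mpoly K[n]}.
Local Notation e := (@order_sgn K 'I_n).
Implicit Types (f : S) (b m : 'X_{1..n}) (A B W s t : {set 'I_n}) (i j : 'I_n).
Implicit Types (D : pred {set 'I_n}).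

Definition kos1 (c : {set 'I_n} -> S) B : S := \sum_(i | i \notin B) kcoef K i B * c (i |: B).

Lemma mcoeff_kos1 c B m :
  (kos1 c B)@_m = \sum_(i | (i \notin B) && (m i != 0%N)) e i B * (c (i |: B))@_(m - U_(i)).
Proof.
rewrite /kos1 raddf_sum /= big_mkcondr; apply: eq_bigr => i _.
by rewrite /kcoef -scalerAl mcoeffZ mcoeffXM; case: ifP; rewrite ?mulr0.
Qed.

Definition msupport m : {set 'I_n} := [set i | m i != 0%N].
(** For a simplicial complex [D], its Stanley-Reisner ideal: it is generated
    by the squarefree monomials whose variables do not form a face. *)
Definition vanish_on D f := forall m, D (msupport m) -> f@_m = 0.

(** Taking complements in [W] turns the Koszul differential, which removes
    an index, into a coboundary; these are the resulting signs. *)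
Definition compl_sgn W i s : K := e i (W :\: (i |: s)).

Lemma compl_sgn_signs W D : (forall s, D s -> s \subset W) -> signs D (compl_sgn W).
Proof.
move=> DW; have [e1 eN] := @order_sgn_signs K 'I_n predT.
split=> [i s|i j s ij is_ js /DW sW]; first exact: e1.
rewrite /compl_sgn; set B := W :\: (i |: (j |: s)).
have [iW jW] : i \in W /\ j \in W by split; apply: (subsetP sW); rewrite !inE eqxx ?orbT.
have -> : W :\: (i |: s) = j |: B.
  apply/setP=> k; rewrite !inE; case: (eqVneq k j) => [->|_] //=.
  by rewrite eq_sym (negPf ij) (negPf js) jW.
have -> : W :\: (j |: s) = i |: B.
  apply/setP=> k; rewrite !inE; case: (eqVneq k i) => [->|_] //=.
  by rewrite (negPf ij) (negPf is_) iW.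
have -> : W :\: (j |: (i |: s)) = B by rewrite setUCA.
have iB : i \notin B by rewrite !inE eqxx.
have jB : j \notin B by rewrite !inE eqxx orbT.
have := eN j i B _ jB iB isT; rewrite eq_sym => /(_ ij).
by rewrite mulrC => ->; rewrite mulrC.
Qed.

(** In multidegree [b], the Koszul complex modulo [vanish_on D] has a basis
    of the sets [A] in the support of [b] such that the support of [b - A]
    is a face of [D]. After passing from [A] to its complement in the
    support of [b], its differential is the coboundary of the complex
    defined here. *)
Definition strand_cplx D b : pred {set 'I_n} := fun s =>
  (s \subset msupport b) && D (msupport (b - mesym1 (msupport b :\: s))).

Lemma mesym1E A i : mesym1 A i = (i \in A) :> nat.
Proof. exact: mnmE. Qed.

Lemma lep_mesym1 A m : (mesym1 A <= m)%MM = (A \subset msupport m).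
Proof.
apply/mnm_lepP/subsetP => h i; last first.
  by rewrite mesym1E; case: (boolP (i \in A)) => // /h; rewrite inE lt0n.
by move=> iA; have := h i; rewrite mesym1E iA inE lt0n.
Qed.

Lemma mesym1U1 i A : i \notin A -> mesym1 (i |: A) = (U_(i) + mesym1 A)%MM.
Proof.
move=> iA; apply/mnmP=> j; rewrite mnmDE mnm1E !mesym1E !inE eq_sym.
by case: (eqVneq i j) => [<-|]; rewrite ?(negPf iA).
Qed.

Lemma msupportS m m' : (m <= m')%MM -> msupport m \subset msupport m'.
Proof.
move=> /mnm_lepP le; apply/subsetP=> i; rewrite !inE -!lt0n => h.
exact: leq_trans (le i).
Qed.

Lemma strand_down D b : down_closed D -> down_closed (strand_cplx D b).
Proof.
move=> dD s t st /andP[tb Dt]; rewrite /strand_cplx (subset_trans st tb).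
apply: dD Dt; apply: msupportS; apply/mnm_lepP=> i; rewrite !mnmBE leq_sub2l //.
rewrite !mesym1E !inE; case: (boolP (i \in s)) => [/(subsetP st)->|_] //.
by case: (i \in t); case: (b i != 0%N).
Qed.

(** Every coefficient of a Koszul chain belongs to a single multidegree, and
    only finitely many multidegrees have total degree [d + a], so primitives
    found strand by strand add up to polynomials. *)
Lemma boundary_of_strands D d a (c : {set 'I_n} -> S) : down_closed D ->
  (forall A, #|A| = d -> homog_diff a 0 (c A)) ->
  (forall B, #|B|.+1 = d -> vanish_on D (kos1 c B)) ->
  (forall b, mdeg b = (d + a)%N -> (d <= #|msupport b|)%N ->
     ~ cohom_nz e (strand_cplx D b) (#|msupport b| - d)) ->
  exists h : {set 'I_n} -> S, (forall A, #|A| = d.+1 -> homog_diff a 1 (h A)) /\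
    forall A, #|A| = d -> vanish_on D (kos1 h A - c A).
Proof.
move=> dD chom cN nz.
have /choice_fun [y yP] : forall b, exists y : {set 'I_n} -> K, mdeg b = (d + a)%N ->
    forall A, A \subset msupport b -> #|A| = d -> D (msupport (b - mesym1 A)) ->
    \sum_(i in msupport b :\: A) e i A * y (i |: A) = (c A)@_(b - mesym1 A).
  move=> b; have [db|db] := eqVneq (mdeg b) (d + a)%N; last first.
    by exists (fun=> 0) => /eqP; rewrite (negPf db).
  have [le|gt] := leqP d #|msupport b|; last first.
    exists (fun=> 0) => _ A /subset_leq_card Ab Ad.
    by move: gt; rewrite -Ad ltnNge Ab.
  set W := msupport b in le *.
  have cD : forall s, strand_cplx D b s -> s \subset W by move=> s /andP[].
  have := nz b db le => nzb.
  have {nzb} : ~ cohom_nz (compl_sgn W) (strand_cplx D b) (#|W| - d).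
    move=> h; apply: nzb; apply: cohom_nz_sign h;
      [exact: strand_down | exact: compl_sgn_signs | exact: order_sgn_signs].
  pose z s := (c (W :\: s))@_(b - mesym1 (W :\: s)).
  case/(cohom_nzN (z := z)) => [t Dt td|y yE].
    have tW := cD _ Dt; pose B := W :\: t.
    have Bd : #|B|.+1 = d by have := cardsID t W; rewrite (setIidPr tW) td -/B; lia.
    have := cN B Bd (b - mesym1 B)%MM; case/andP: (Dt) => _ -> /(_ isT).
    rewrite mcoeff_kos1 => E; rewrite -[RHS]E /cobd; apply: eq_big => i.
      have Wi : (i \in W) = (b i != 0%N) by rewrite inE.
      rewrite mnmBE mesym1E !inE ?Wi; case: (boolP (i \in t)) => it /=.
        by rewrite subn0 -[RHS]Wi (subsetP tW).
      by case: (b i).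
    move=> it; have iW := subsetP tW i it.
    rewrite /compl_sgn setD1K // /z setDD1 // -/B mesym1U1 ?inE ?it //.
    by rewrite addmC submDA.
  exists (fun A => y (W :\: A)) => _ A Ab Ad DA.
  have WA := setDDK Ab.
  have := yE (W :\: A); rewrite /strand_cplx subsetDl WA DA /= => /(_ isT).
  rewrite /z WA => <-; last by rewrite cardsD (setIidPr Ab) Ad.
  apply: eq_bigr => i iWA; rewrite /compl_sgn setD1K // WA.
  by congr (_ * y _); rewrite setDDl setUC.
(* [y b] solves the strand of multidegree [b]. *)
pose h A : S := \sum_(b : 'X_{1..n < (d + a).+1} | (mdeg b == (d + a)%N) && (A \subset msupport b))
   y b A *: 'X_[b - mesym1 A].
have hE A m : (h A)@_m = if (mdeg m + #|A| == d + a)%N then y (m + mesym1 A)%MM A else 0.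
  rewrite /h raddf_sum /=; have dmA : mdeg (m + mesym1 A)%MM = (mdeg m + #|A|)%N.
    by rewrite mdegD mdeg_mesym1.
  have AmA : A \subset msupport (m + mesym1 A)%MM by rewrite -lep_mesym1 lem_addl.
  case: ifP => [/eqP mA|mA].
    have lt : (mdeg (m + mesym1 A)%MM < (d + a).+1)%N by rewrite dmA mA.
    rewrite (bigD1 (BMultinom lt)) /=; last by rewrite dmA mA eqxx.
    rewrite mcoeffZ mcoeffX addmK eqxx mulr1 big1 ?addr0 // => b /andP[/andP[_ Ab] bm].
    rewrite mcoeffZ mcoeffX; case: eqP => [E|_]; last by rewrite mulr0.
    by case/eqP: bm; apply/val_inj; rewrite /= -E submK // lep_mesym1.
  rewrite big1 // => b /andP[/eqP db Ab]; rewrite mcoeffZ mcoeffX.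
  case: eqP => [E|_]; last by rewrite mulr0.
  by move: mA; rewrite -dmA -E submK ?lep_mesym1 // db eqxx.
exists h; split=> [A Ad|A Ad m Dm].
  apply/homog_diffP => m; rewrite hE Ad; case: ifP => [/eqP + _|_]; last by rewrite eqxx.
  by lia.
rewrite mcoeffB mcoeff_kos1; apply/eqP; rewrite subr_eq0; apply/eqP.
have [ma|ma] := eqVneq (mdeg m) a; last first.
  have -> : (c A)@_m = 0.
    apply/eqP; apply: contraNT ma => /(homog_diffP _ _ _ (chom A Ad)).
    by rewrite addn0 => ->.
  apply: big1 => i /andP[iA mi]; rewrite hE cardsU1 iA Ad ifN ?mulr0 //.
  apply: contraNneq ma; have : mdeg m = (mdeg (m - U_(i)) + 1)%N.
    by rewrite -(mdeg1 i) -mdegD submK // lep1mP.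
  by move=> ->; lia.
pose b := (m + mesym1 A)%MM.
have bA : (b - mesym1 A)%MM = m by rewrite addmK.
have Ab : A \subset msupport b by rewrite -lep_mesym1 lem_addl.
have := yP b; rewrite mdegD mdeg_mesym1 ma Ad addnC => /(_ erefl A Ab Ad).
rewrite bA => /(_ Dm) <-; apply: eq_big => i.
  rewrite !inE mnmDE mesym1E; case: (boolP (i \in A)) => //=; by rewrite addn0.
move=> /andP[iA mi]; rewrite hE; congr (_ * _).
have mE : (m - U_(i) + mesym1 (i |: A))%MM = b.
  by rewrite mesym1U1 // addmA submK // lep1mP.
rewrite ifT; first by rewrite mE.
by rewrite -mdeg_mesym1 -mdegD mE mdegD mdeg_mesym1 ma Ad addnC.
Qed.

(** The strand of the squarefree multidegree [W] embeds into the Koszul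
    complex by attaching to each face of [D] in [W] the product of its
    variables. *)
Lemma squarefree_strand_cycle D d a W : down_closed D -> #|W| = (d + a)%N ->
  cohom_nz e (fun s : {set 'I_n} => (s \subset W) && D s) a ->
  exists c : {set 'I_n} -> S,
    [/\ forall A, #|A| = d -> homog_diff a 0 (c A),
        forall B, #|B|.+1 = d -> vanish_on D (kos1 c B) &
        ~ exists h : {set 'I_n} -> S, forall A, #|A| = d -> vanish_on D (kos1 h A - c A)].
Proof.
move=> dD Wd; set DW := (fun s => _).
have dDW : down_closed DW.
  by move=> s t st /andP[tW Dt]; rewrite /DW (subset_trans st tW) (dD _ _ st Dt).
have DWW s : DW s -> s \subset W by case/andP.
move=> /(cohom_nz_sign dDW (@order_sgn_signs K _ DW) (compl_sgn_signs DWW)) [z [zc nb]].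
pose c A : S := if A \subset W then z (W :\: A) *: 'X_[mesym1 (W :\: A)] else 0.
have supp1 A : msupport (mesym1 A) = A.
  by apply/setP=> i; rewrite inE mesym1E; case: (i \in A).
have WK := @setDDK _ W.
exists c; split=> [A Ad|B Bd m Dm|[h hE]].
- rewrite /c; case: ifP => AW; last exact: homog_diff0.
  apply/homog_diffP => m; rewrite mcoeffZ mcoeffX.
  case: (eqVneq _ m) => [<- _|_]; last by rewrite mulr0 eqxx.
  by rewrite mdeg_mesym1 addn0 cardsD (setIidPr AW) Wd Ad addKn.
- rewrite mcoeff_kos1.
  have [/andP[BW /eqP mE]|nm] := boolP ((B \subset W) && (m == mesym1 (W :\: B))); last first.
    apply: big1 => i /andP[iB mi]; rewrite /c subUset sub1set.
    case: ifP => [/andP[iW BW]|_]; last by rewrite mcoeff0 mulr0.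
    rewrite mcoeffZ mcoeffX; case: eqP => [E|_]; last by rewrite !mulr0.
    case/negP: nm; rewrite BW; apply/eqP.
    rewrite -(submK (m := U_(i)) (m' := m)) ?lep1mP // -E addmC.
    rewrite -mesym1U1; last by rewrite !inE eqxx.
    congr mesym1; apply/setP=> j; rewrite !inE.
    by case: (eqVneq j i) => [->|]; rewrite ?iB ?iW.
  have Dt : DW (W :\: B) by rewrite /DW subsetDl /=; move: Dm; rewrite mE supp1.
  have td : #|W :\: B| = a.+1 by rewrite cardsD (setIidPr BW) Wd; lia.
  rewrite -[RHS](zc _ Dt td) /cobd; apply: eq_big => i.
    by rewrite mE mesym1E !inE; case: (i \in B); case: (i \in W).
  rewrite mE mesym1E !inE => /andP[iB]; rewrite iB /= => iW.
  have {}iW : i \in W by case: (i \in W) iW.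
  rewrite /c subUset sub1set iW BW /=.
  have sE : W :\: (i |: B) = (W :\: B) :\ i by rewrite setDDl setUC.
  have iWB : i \in W :\: B by rewrite !inE iB.
  rewrite /compl_sgn setD1K // WK // sE mcoeffZ mcoeffX.
  suff -> : (mesym1 (W :\: B) - U_(i))%MM = mesym1 (W :\: B :\ i) by rewrite eqxx mulr1.
  rewrite -[in LHS](setD1K iWB) mesym1U1; last by rewrite !inE eqxx.
  by rewrite addmC addmK.
apply: nb; exists (fun s => (h (W :\: s))@_(mesym1 s)) => s /andP[sW Ds] sd.
have Ad : #|W :\: s| = d by rewrite cardsD (setIidPr sW) Wd sd addnK.
have := hE _ Ad (mesym1 s); rewrite supp1 => /(_ Ds).
rewrite mcoeffB => /eqP; rewrite subr_eq0 => /eqP.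
rewrite /c subsetDl WK // mcoeffZ mcoeffX eqxx mulr1 => <-.
rewrite mcoeff_kos1 /cobd; apply: eq_big => i.
  rewrite mesym1E !inE; case: (boolP (i \in s)) => [is_|]; last by rewrite andbF.
  by rewrite (subsetP sW).
move=> is_; have iW := subsetP sW i is_.
rewrite /compl_sgn setD1K //; congr (_ * _).
rewrite setDD1 //.
congr (_ @_ _); rewrite -[in RHS](setD1K is_) mesym1U1; last by rewrite !inE eqxx.
by rewrite addmC addmK.
Qed.

Lemma homog_shift (a b c : nat) (f : S) : homog_diff (a + c) (b + c) f = homog_diff a b f.
Proof.
by apply/homog_diffP/homog_diffP => h m /h; lia.
Qed.

(** For the full simplex every strand of nonzero multidegree is a cone. *)
Lemma free_exact_poly a d (c : {set 'I_n} -> S) :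
  (forall A, #|A| = d -> homog_diff a 0 (c A)) ->
  (forall B, #|B|.+1 = d -> kos1 c B = 0) ->
  (d = 0%N -> (c set0)@_0%MM = 0) ->
  exists h, (forall A, #|A| = d.+1 -> homog_diff a 1 (h A)) /\
    forall A, #|A| = d -> kos1 h A = c A.
Proof.
move=> chom cN c0; have [da|da] := eqVneq (d + a)%N 0%N.
  exists (fun=> 0); split=> [A _|A]; first exact: homog_diff0.
  rewrite /kos1 big1; last by move=> i _; rewrite mulr0.
  have [d0 a0] : d = 0%N /\ a = 0%N by move: da; lia.
  rewrite d0 => /cards0_eq ->; apply/mpolyP=> m; rewrite mcoeff0.
  have [->|mc] := eqVneq m 0%MM; first by rewrite c0.
  apply/esym/eqP; apply: contraNT mc => /(homog_diffP _ _ _ (chom set0 _)).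
  by rewrite cards0 => /(_ (esym d0)) /eqP; rewrite a0 addn0 mdeg_eq0.
have [] := @boundary_of_strands predT d a c.
- by [].
- exact: chom.
- by move=> B /cN -> m _; rewrite mcoeff0.
- move=> b db _; have /set0Pn [i ib] : msupport b != set0.
    apply: contraNneq da => b0; rewrite -db mdeg_eq0; apply/eqP/mnmP=> i; rewrite mnm0E.
    by apply/eqP; have := in_set0 i; rewrite -b0 inE => /negbFE.
  apply: (@cone_acyclic _ _ _ _ i); first exact: order_sgn_signs.
  move=> s /andP[sb _].
  by rewrite /strand_cplx subUset sub1set ib sb.
move=> h [hh hc]; exists h; split=> // A Ad; apply/eqP; rewrite -subr_eq0; apply/eqP.
by apply/mpolyP=> m; rewrite mcoeff0 hc.
Qed.

Lemma kosE r (c : {set 'I_n} -> 'rV[S]_r) B k :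
  kos c B 0 k = kos1 (fun A => c A 0 k) B.
Proof. by rewrite /kos summxE; apply: eq_bigr => i _; rewrite mxE. Qed.

(** The primitive [h] has degree [a - 1]. Raising the degrees of the
    generators by one states this also for [a = 0], where [h] is zero. *)
Lemma free_exact r (deg : 'I_r -> nat) a d (c : {set 'I_n} -> 'rV[S]_r) :
  (forall A, #|A| = d -> homog_row deg a (c A)) ->
  (forall B, #|B|.+1 = d -> kos c B = 0) ->
  (d = 0%N -> forall k, (c set0 0 k)@_0%MM = 0) ->
  exists h : {set 'I_n} -> 'rV[S]_r,
    (forall A, #|A| = d.+1 -> homog_row (fun k => (deg k).+1) a (h A)) /\
    forall A, #|A| = d -> kos h A = c A.
Proof.
move=> chom cN c0.
have /choice_fun [h hP] : forall k, exists h : {set 'I_n} -> S,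
    (forall A, #|A| = d.+1 -> homog_diff a (deg k).+1 (h A)) /\
    forall A, #|A| = d -> kos1 h A = c A 0 k.
  move=> k; have [le|lt] := leqP (deg k) a.
    have [|||h [hh hc]] := @free_exact_poly (a - deg k) d (fun A => c A 0 k).
    - by move=> A /chom /(_ k); rewrite -(homog_shift (a - deg k) 0 (deg k)) subnK ?add0n.
    - by move=> B /cN E; rewrite -kosE E mxE.
    - by move=> /c0.
    by exists h; split=> // A /hh; rewrite -(homog_shift _ 1 (deg k)) subnK.
  exists (fun=> 0); split=> [A _|A /chom /(_ k)]; first exact: homog_diff0.
  rewrite /homog_diff leqNgt lt /= => /eqP->.
  by rewrite /kos1 big1 // => i _; rewrite mulr0.
exists (fun A => \row_k h k A); split=> A Ad.
  by move=> k; rewrite mxE; apply: (hP k).1.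
apply/rowP=> k; rewrite kosE -(hP k).2 //.
by apply: eq_bigr => i _; rewrite mxE.
Qed.

(** If [b i >= 2] then [i] stays in the support when one of its copies is
    removed, hence is the apex of a cone. Only squarefree multidegrees
    remain. *)
Lemma hochster D d a : down_closed D ->
  koszul_nz (fun _ : 'I_1 => 0%N) (fun _ => True) (fun v => vanish_on D (v 0 0)) d a <->
  exists2 W : {set 'I_n}, #|W| = (d + a)%N &
    cohom_nz e (fun s : {set 'I_n} => (s \subset W) && D s) a.
Proof.
move=> dD; split=> [[c [c1 c2 c3]]|[W Wd nzW]]; last first.
  have [c [c1 c2 c3]] := squarefree_strand_cycle dD Wd nzW.
  exists (fun A => const_mx (c A)); split=> [A Ad|B Bd|[h [_ hh]]].
  - by split=> // k; rewrite mxE c1.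
  - move=> m Dm; rewrite kosE; have := c2 _ Bd m Dm.
    by congr (_@__ = _); apply: eq_bigr => i _; rewrite mxE.
  apply: c3; exists (fun A => h A 0 0) => A Ad m Dm; rewrite -kosE.
  by have := hh A Ad m Dm; rewrite !mxE.
apply: NNPP => no; apply: c3.
have [] := @boundary_of_strands D d a (fun A => c A 0 0) dD.
- by move=> A /c1 [_ /(_ 0)].
- by move=> B /c2; rewrite kosE.
- move=> b db dle; case: (boolP [exists i, (1 < b i)%N]) => [/existsP[i bi]|nb].
    apply: (@cone_acyclic _ _ _ _ i); first exact: order_sgn_signs.
    have ib : i \in msupport b by rewrite inE -lt0n ltnW.
    move=> s /andP[sb Ds]; rewrite /strand_cplx subUset sub1set ib sb /=.
    suff -> : msupport (b - mesym1 (msupport b :\: (i |: s)))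
            = msupport (b - mesym1 (msupport b :\: s)) by [].
    apply/setP=> j; rewrite !inE !mnmBE !mesym1E !inE.
    case: (eqVneq j i) => [->|_] //=; case: (i \in s) => //=.
    by case: (b i) bi => [|[|k]].
  have b1 i : (b i <= 1)%N by move: nb; rewrite negb_exists => /forallP /(_ i); rewrite -leqNgt.
  have bE : b = mesym1 (msupport b).
    by apply/mnmP=> i; rewrite mesym1E inE; case: (b i) (b1 i) => [|[]].
  move=> nz; apply: no; exists (msupport b); first by rewrite -mdeg_mesym1 -bE.
  have -> : a = (#|msupport b| - d)%N.
    by rewrite -mdeg_mesym1 -bE db addKn.
  apply: eq_cohom_nz nz => s; rewrite /strand_cplx; case: (boolP (s \subset _)) => //= sb.
  congr (D _); apply/setP=> i; rewrite !inE mnmBE mesym1E !inE.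
  case: (boolP (i \in s)) => [/(subsetP sb)|_] /=; first by rewrite inE subn0.
  by case: (b i) (b1 i) => [|[]].
move=> h [_ hc]; exists (fun A => const_mx (h A)); split=> // A Ad m Dm.
rewrite !mxE kosE; have := hc A Ad m Dm; congr (_@__ = _); congr (_ - _).
by apply: eq_bigr => i _; rewrite mxE.
Qed.
End Strands.

(** * Dimension shifting along a resolution *)

Section Shift.
Variables (K : fieldType) (n : nat).
Local Notation S := {mpoly K[n]}.
Implicit Types (A B : {set 'I_n}) (d a : nat).

Definition is0 r (v : 'rV[S]_r) : Prop := v = 0.

Lemma gsub_is0 r (deg : 'I_r -> nat) : gsub deg (@is0 r).
Proof.
rewrite /is0; split=> // [v w -> ->|p v ->|a v ->]; first exact: addr0.
  exact: scaler0.
exact: gproj0.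
Qed.

Lemma kos_gproj r (deg : 'I_r -> nat) (c : {set 'I_n} -> 'rV[S]_r) B a :
  gproj deg a.+1 (kos c B) = kos (fun A => gproj deg a (c A)) B.
Proof.
apply/rowP=> k; rewrite mxE !kosE gpart_sum; apply: eq_bigr => i _.
by rewrite mulrC (gpartM _ _ (kcoef_homog K (deg k) i B)) mulrC mxE.
Qed.

Lemma kos_coef0 r (c : {set 'I_n} -> 'rV[S]_r) B k : (kos c B 0 k)@_0%MM = 0.
Proof. by rewrite kosE mcoeff_kos1 big_pred0 // => i; rewrite mnm0E andbF. Qed.

Section Pres.
Variables (r r' : nat) (deg : 'I_r -> nat) (deg' : 'I_r' -> nat).
Variables (Z N : 'rV[S]_r -> Prop) (phi : 'M[S]_(r', r)).
Hypothesis gN : gsub deg N.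
Hypothesis phi_homog : forall k l, homog_diff (deg' k) (deg l) (phi k l).
Hypothesis phiZ : forall v, Z (v *m phi).
Hypothesis phi_surj : forall z, Z z -> exists v, N (z - v *m phi).
Definition relations (v : 'rV[S]_r') : Prop := N (v *m phi).
Hypothesis phi_min : forall v, relations v -> forall k, (v 0 k)@_0%MM = 0.

Lemma gsub_relations : gsub deg' relations.
Proof.
split; rewrite /relations.
- by rewrite mul0mx; apply: (gsub0 gN).
- by move=> v w; rewrite mulmxDl; apply: (gsubD gN).
- by move=> p v; rewrite -scalemxAl; apply: (gsubZ gN).
by move=> a v; rewrite -(gproj_mul _ _ phi_homog); apply: (gsub_proj gN).
Qed.

Lemma lift_homog a z : Z z -> homog_row deg a z ->
  exists v, homog_row deg' a v /\ N (z - v *m phi).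
Proof.
move=> /phi_surj [v Nv] hz; exists (gproj deg' a v); split; first exact: gproj_hom.
rewrite -(gproj_mul _ _ phi_homog).
have := gsub_proj gN a Nv.
by rewrite gprojB (gproj_id _ hz) eqxx.
Qed.

Lemma lift_chain a d (c : {set 'I_n} -> 'rV[S]_r) :
  (forall A, #|A| = d -> Z (c A) /\ homog_row deg a (c A)) ->
  exists f : {set 'I_n} -> 'rV[S]_r',
    forall A, #|A| = d -> homog_row deg' a (f A) /\ N (c A - f A *m phi).
Proof.
move=> hc; apply: (@choice_fun _ _
  (fun A v => #|A| = d -> homog_row deg' a v /\ N (c A - v *m phi))) => A.
have [Ad|Ad] := eqVneq #|A| d; last by exists 0 => /eqP; rewrite (negPf Ad).
by have [ZA hA] := hc A Ad; have [v vP] := lift_homog ZA hA; exists v.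
Qed.

Lemma lift_chain_any d (c : {set 'I_n} -> 'rV[S]_r) :
  (forall A, #|A| = d -> Z (c A)) ->
  exists f : {set 'I_n} -> 'rV[S]_r', forall A, #|A| = d -> N (c A - f A *m phi).
Proof.
move=> hc; apply: (@choice_fun _ _ (fun A v => #|A| = d -> N (c A - v *m phi))) => A.
have [Ad|Ad] := eqVneq #|A| d; last by exists 0 => /eqP; rewrite (negPf Ad).
by have [v vP] := phi_surj (hc A Ad); exists v.
Qed.

(** The connecting map of the presentation of [Z/N], lift and differentiate,
    is injective because the Koszul complex of the free module is exact in
    positive homological degree. *)
Lemma koszul_shift d a :
  koszul_nz deg Z N d.+1 a -> koszul_nz deg' relations (@is0 r') d a.+1.
Proof.
case=> c [c1 c2 c3]; have [f fP] := lift_chain c1.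
have fh A : #|A| = d.+1 -> homog_row deg' a (f A) by case/fP.
have Nf A : #|A| = d -> relations (kos f A).
  move=> Ad; rewrite /relations -kos_mul.
  have -> : kos (fun A => f A *m phi) A = kos c A - kos (fun A => c A - f A *m phi) A.
    by rewrite kosB opprB addrC subrK.
  apply: (gsubB gN); first by apply: c2; rewrite Ad.
  by apply: (kos_gsub gN) => B; rewrite Ad => /fP [].
exists (kos f); split=> [A Ad|B Bd|[g [g1 g2]]].
- by split; [exact: Nf | apply: kos_hom => B; rewrite Ad => /fh].
- exact: kos_kos.
apply: c3; pose g' A := gproj deg' a (g A).
have g'1 A : #|A| = d.+1 -> relations (g' A).
  by move=> /g1; apply: (gsub_proj gsub_relations).
have g'2 A : #|A| = d -> kos g' A = kos f A.
  move=> Ad; rewrite -kos_gproj.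
  have /eqP := g2 _ Ad; rewrite subr_eq0 => /eqP->.
  by rewrite (gproj_id (a := a.+1)) ?eqxx //; apply: kos_hom => B; rewrite Ad => /fh.
have [|||h [_ hP]] := @free_exact K n r' deg' a d.+1 (fun A => f A - g' A).
- by move=> A Ad; apply: homog_rowB; [exact: fh | exact: gproj_hom].
- by move=> B [Bd]; rewrite kosB g'2 // subrr.
- by [].
exists (fun A => h A *m phi); split=> [A _|A Ad]; first exact: phiZ.
rewrite kos_mul hP // mulmxBl addrAC; apply: (gsubB gN); last exact: g'1.
by rewrite -opprB; apply: (gsubN gN); case: (fP A Ad).
Qed.

(** The connecting map is onto. For [d = 0] the Koszul complex of the free
    module is exact only at elements without constant coefficients, and the
    relations are such elements. *)
Lemma koszul_unshift d a :
  koszul_nz deg' relations (@is0 r') d a.+1 -> koszul_nz deg Z N d.+1 a.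
Proof.
case=> z [z1 z2 z3].
have [|||f [f1 f2]] := @free_exact K n r' deg' a.+1 d z.
- by move=> A /z1 [].
- by move=> B /z2.
- by move=> d0 k; apply: phi_min; apply: (z1 _ _).1; rewrite cards0.
exists (fun A => f A *m phi); split=> [A Ad|B [Bd]|[b [b1 b2]]].
- split; first exact: phiZ.
  apply: (homog_row_mul phi_homog) => k.
  by move: (f1 A Ad k); rewrite -addn1 -[(deg' k).+1]addn1 homog_shift.
- by rewrite kos_mul f2 //; case: (z1 B Bd).
apply: z3; have [g gP] := lift_chain_any b1.
exists (fun A => f A - kos g A); split=> [A Ad|A Ad]; last first.
  by rewrite /is0 kosB kos_kos subr0 f2 // subrr.
rewrite /relations mulmxBl -kos_mul.
have -> : f A *m phi - kos (fun A => g A *m phi) A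
        = kos (fun A => b A - g A *m phi) A - (kos b A - f A *m phi).
  by rewrite kosB opprB [RHS]addrC addrA subrK.
apply: (gsubB gN); last exact: b2.
by apply: (kos_gsub gN) => B; rewrite Ad => /gP.
Qed.

(** The preimage under the connecting map would have degree [-1]. *)
Lemma koszul_relations0 d : ~ koszul_nz deg' relations (@is0 r') d 0.
Proof.
case=> z [z1 z2 z3].
have [|||f [f1 f2]] := @free_exact K n r' deg' 0 d z.
- by move=> A /z1 [].
- by move=> B /z2.
- by move=> d0 k; apply: phi_min; apply: (z1 _ _).1; rewrite cards0.
apply: z3; exists (fun=> 0); split=> [A _|A Ad]; first exact: (gsub0 gsub_relations).
rewrite /is0 -f2 // -kosB /kos big1 // => i iA.
have -> : f (i |: A) = 0; last by rewrite subrr scaler0.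
apply/rowP=> k; have := f1 (i |: A); rewrite cardsU1 iA Ad => /(_ erefl k).
by rewrite /homog_diff /= mxE => /eqP.
Qed.

(** Nakayama's lemma: in homological degree 0 the homology is [Z/N] modulo
    the variables, of which minimal generators form a basis. *)
Lemma koszul_generators a : koszul_nz deg Z N 0 a <-> exists k, deg' k = a.
Proof.
split=> [[c [c1 _ c3]]|[k ka]].
  apply: NNPP => no; apply: c3; have [Zc hc] := c1 set0 (cards0 _).
  have [f [f1 f2]] := lift_homog Zc hc.
  have [|||h [_ hP]] := @free_exact K n r' deg' a 0 (fun=> f).
  - by [].
  - by [].
  - move=> _ k; apply/eqP; apply: contra_notT no => /(homog_diffP _ _ _ (f1 k)).
    by rewrite mdeg0 => <-; exists k.
  exists (fun A => h A *m phi); split=> [A _|A /cards0_eq ->]; first exact: phiZ.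
  by rewrite kos_mul hP ?cards0 // -opprB; apply: (gsubN gN).
exists (fun=> row k phi); split=> // [A _|[b [b1 b2]]].
  split; first by rewrite rowE; apply: phiZ.
  by move=> l; rewrite mxE -ka.
have [g gP] := lift_chain_any b1.
have /phi_min /(_ k) : relations (delta_mx 0 k - kos g set0).
  rewrite /relations mulmxBl -kos_mul -rowE.
  have -> : row k phi - kos (fun A => g A *m phi) set0
     = kos (fun A => b A - g A *m phi) set0 - (kos b set0 - row k phi).
    by rewrite kosB opprB [RHS]addrC addrA subrK.
  apply: (gsubB gN); last by apply: b2; rewrite cards0.
  by apply: (kos_gsub gN) => B; rewrite cards0 => /gP.
have rowB (x y : 'rV[S]_r') : (x - y) 0 k = x 0 k - y 0 k by rewrite !mxE.
rewrite rowB mcoeffB kos_coef0 subr0 mxE !eqxx.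
by rewrite mcoeff1 eqxx => /eqP; rewrite oner_eq0.
Qed.
End Pres.
End Shift.

Section Chain.
Variables (K : fieldType) (n : nat) (I : {mpoly K[n]} -> Prop).
Local Notation S := {mpoly K[n]}.
Definition ideal_row (v : 'rV[S]_1) : Prop := I (v 0 0).
Definition deg0 (_ : 'I_1) := 0%N.
(** Nonvanishing of [Tor_d(S/I, K)] in internal degree [d + a]. *)
Definition tor_nz d a := koszul_nz deg0 (fun _ => True) ideal_row d a.
Hypothesis gI : gsub deg0 ideal_row.

Variable F : min_res I.

Definition syz q : 'rV[S]_(rk F q) -> Prop :=
  match q with
  | 0 => fun v => I ((v *m aug F) 0 0)
  | q'.+1 => fun v => v *m dif F q' = 0
  end.

Lemma aug_homog_row k l : homog_diff (@deg _ _ _ F 0 k) (deg0 l) (aug F k l).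
Proof. by rewrite ord1; apply: aug_homog. Qed.

Lemma aug_surj_row (z : 'rV[S]_1) : True -> exists v, ideal_row (z - v *m aug F).
Proof.
move=> _; have [v vP] := aug_surj F (z 0 0); exists v.
by rewrite /ideal_row !mxE; rewrite mxE in vP.
Qed.

Lemma coef0_mul_dif q (w : 'rV[S]_(rk F q.+1)) k : ((w *m dif F q) 0 k)@_0%MM = 0.
Proof.
rewrite mxE raddf_sum /= big1 // => i _.
by rewrite rmorphM /= dif_min mulr0.
Qed.

Lemma syz_min q v : @syz q v -> forall k, (v 0 k)@_0%MM = 0.
Proof.
case: q v => [|q] v /=.
  by move=> /aug_exact [w ->] k; apply: coef0_mul_dif.
by move=> /dif_exact [w ->] k; apply: coef0_mul_dif.
Qed.

Lemma dif_surj q (z : 'rV[S]_(rk F q)) : @syz q z -> exists v, is0 (z - v *m dif F q).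
Proof.
case: q z => [|q] z /=.
  by move=> /aug_exact [w ->]; exists w; rewrite /is0 subrr.
by move=> /dif_exact [w ->]; exists w; rewrite /is0 subrr.
Qed.

Lemma syz_dif q v : @syz q (v *m dif F q).
Proof. by case: q v => [|q] v /=; [apply/aug_exact | apply/dif_exact]; exists v. Qed.

Lemma koszul_syz q d a : koszul_nz (@deg _ _ _ F q) (@syz q) (@is0 _ _ _) d a <->
  exists2 a', a = (a' + q.+1)%N & tor_nz (d + q.+1) a'.
Proof.
elim: q d a => [|q IH] d [|a].
- split=> [|[a']]; last by rewrite addn1.
  by move=> /(koszul_relations0 gI aug_homog_row (@syz_min 0)).
- split=> [/(koszul_unshift gI aug_homog_row _ aug_surj_row (@syz_min 0)) h|[a']].
    by exists a; rewrite ?addn1 //; apply: h.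
  rewrite !addn1 => -[<-].
  exact: (koszul_shift gI aug_homog_row _ aug_surj_row).
- split=> [|[a']]; last by rewrite addnS.
  by move=> /(koszul_relations0 (gsub_is0 _ _ _) (@dif_homog _ _ _ F q) (@syz_min q.+1)).
have st := koszul_shift (gsub_is0 _ _ _) (@dif_homog _ _ _ F q) (@syz_dif q) (@dif_surj q).
have us := koszul_unshift (gsub_is0 _ _ _) (@dif_homog _ _ _ F q) (@syz_dif q)
  (@dif_surj q) (@syz_min q.+1).
split=> [/us /IH [a' -> h]|[a' aE h]].
  by exists a'; [rewrite [RHS]addnS | rewrite -addSnnS].
apply: st; apply/IH; exists a'; last by rewrite addSnnS.
by move: aE; rewrite addnS => -[].
Qed.

(** The right side does not mention [F]: all minimal resolutions have
    generators in the same degrees. *)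
Theorem res_betti_neq0 q j : res_betti F q j <> 0%N <->
  exists2 a, j = (a + q)%N & tor_nz q a.
Proof.
transitivity (exists k : 'I_(rk F q), deg k = j).
  rewrite /res_betti; split=> [/eqP|[k kj]].
    by rewrite cards_eq0 => /set0Pn [k]; rewrite inE => /eqP kj; exists k.
  by apply/eqP; rewrite cards_eq0; apply/set0Pn; exists k; rewrite inE kj.
case: q => [|q].
  split=> [|[a ->]].
    move=> /(koszul_generators gI aug_homog_row _ aug_surj_row (@syz_min 0)) h.
    by exists j; rewrite ?addn0 //; apply: h.
  rewrite addn0 => h.
  by apply/(koszul_generators gI aug_homog_row _ aug_surj_row (@syz_min 0)).
have gen := koszul_generators (gsub_is0 _ _ _) (@dif_homog _ _ _ F q) (@syz_dif q)
  (@dif_surj q) (@syz_min q.+1).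
split=> [/gen/koszul_syz [a ja na]|[a ja na]]; first by exists a.
by apply/gen/koszul_syz; exists a.
Qed.
End Chain.

(** * Existence of minimal resolutions *)

Section Span.
Variables (K : fieldType) (n r : nat).
Local Notation S := {mpoly K[n]}.
Implicit Types (v w : 'rV[S]_r) (l : seq 'rV[S]_r).

Fixpoint span l v : Prop :=
  if l is x :: l' then exists p : S, span l' (v - p *: x) else v = 0.

Lemma span0 l : span l 0.
Proof. by elim: l => //= x l IH; exists 0; rewrite scale0r subrr. Qed.

Lemma spanD l v w : span l v -> span l w -> span l (v + w).
Proof.
elim: l v w => [|x l IH] v w /=; first by move=> -> ->; rewrite addr0.
move=> [p hp] [q hq]; exists (p + q).
have -> : v + w - (p + q) *: x = (v - p *: x) + (w - q *: x).
  by rewrite scalerDl opprD addrACA.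
exact: IH.
Qed.

Lemma spanZ l v (p : S) : span l v -> span l (p *: v).
Proof.
elim: l v => [|x l IH] v /=; first by move=> ->; rewrite scaler0.
by move=> [q hq]; exists (p * q); rewrite -scalerA -scalerBr; apply: IH.
Qed.

Lemma span_catr l l' v : span l' v -> span (l ++ l') v.
Proof. by elim: l => //= x l IH h; exists 0; rewrite scale0r subr0; apply: IH. Qed.

Lemma span_catl l l' v : span l v -> span (l ++ l') v.
Proof.
elim: l v => [|x l IH] v /=; first by move=> ->; apply: span0.
by move=> [p /IH h]; exists p.
Qed.

Lemma span_sum l (T : Type) (s : seq T) (P : pred T) F :
  (forall i, P i -> span l (F i)) -> span l (\sum_(i <- s | P i) F i).
Proof.
move=> h; elim/big_rec: _ => [|i v Pi]; first exact: span0.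
by apply: spanD; apply: h.
Qed.

Lemma span_mx l v : span l v ->
  exists w : 'rV[S]_(size l), v = w *m \matrix_i nth 0 l i.
Proof.
move=> h; suff [w wE] : exists w : nat -> S, v = \sum_(i < size l) w i *: nth 0 l i.
  exists (\row_i w i); rewrite mulmx_sum_row wE; apply: eq_bigr => i _.
  by rewrite mxE rowK.
elim: l v h => [|x l IH] v /=; first by move=> ->; exists (fun=> 0); rewrite big_ord0.
move=> [p /IH [w wE]]; exists (fun i => if i is j.+1 then w j else p).
by rewrite big_ord_recl /= -wE addrC subrK.
Qed.

(** Gaussian elimination: one vector with a nonzero first coefficient clears
    that coefficient in all the others. *)
Lemma finite_span (cs : seq ('I_r * 'X_{1..n})) (Q : 'rV[S]_r -> Prop) :
  (forall v w, Q v -> Q w -> Q (v + w)) ->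
  (forall (x : K) v, Q v -> Q (x%:MP *: v)) ->
  (forall v, Q v -> (forall c, c \in cs -> (v 0 c.1)@_c.2 = 0) -> v = 0) ->
  exists l, (forall x, x \in l -> Q x) /\ forall v, Q v -> span l v.
Proof.
elim: cs Q => [|c cs IH] Q QD QZ Qcs; first by exists [::]; split=> // v /Qcs; apply.
have coefD v w : ((v + w) 0 c.1)@_c.2 = (v 0 c.1)@_c.2 + (w 0 c.1)@_c.2 by rewrite mxE mcoeffD.
have coefZ x v : ((x%:MP *: v) 0 c.1)@_c.2 = x * (v 0 c.1)@_c.2 by rewrite mxE mcoeffCM.
case: (classic (exists2 z, Q z & (z 0 c.1)@_c.2 != 0)) => [[z Qz zc]|no]; last first.
  apply: IH => // v Qv vcs; apply: Qcs => // c'; rewrite inE => /orP[/eqP->|]; last exact: vcs.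
  by apply/eqP; apply: contra_notT no => vc; exists v.
have [||v [Qv vc] vcs|l [lQ lspan]] := IH (fun v => Q v /\ (v 0 c.1)@_c.2 = 0).
- by move=> v w [Qv vc] [Qw wc]; split; [exact: QD | rewrite coefD vc wc addr0].
- by move=> x v [Qv vc]; split; [exact: QZ | rewrite coefZ vc mulr0].
- by apply: Qcs => // c'; rewrite inE => /orP[/eqP->|/vcs].
exists (z :: l); split=> [x|v Qv /=]; first by rewrite inE => /orP[/eqP->|/lQ []].
exists ((v 0 c.1)@_c.2 / (z 0 c.1)@_c.2)%:MP; apply: lspan.
rewrite -scaleNr -mpolyCN; split; first by apply: QD => //; apply: QZ.
by rewrite coefD coefZ mulNr divfK // subrr.
Qed.
End Span.

Section Generators.
Variables (K : fieldType) (n r : nat) (deg : 'I_r -> nat).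
Local Notation S := {mpoly K[n]}.
Variable Z : 'rV[S]_r -> Prop.
Hypothesis gZ : gsub deg Z.

(** In each degree a vector is determined by its coefficients at finitely
    many monomials. *)
Lemma generators_upto J : exists l : seq (nat * 'rV[S]_r),
  (forall x, x \in l -> Z x.2 /\ homog_row deg x.1 x.2) /\
  forall j v, (j < J)%N -> Z v -> homog_row deg j v -> span [seq x.2 | x <- l] v.
Proof.
elim: J => [|J [l [lZ lspan]]]; first by exists [::].
pose cs := [seq (k, bmnm m) | k <- enum 'I_r, m <- enum {: 'X_{1..n < J.+1}}].
have [|||l' [l'Q l'span]] := @finite_span K n r cs (fun v => Z v /\ homog_row deg J v).
- by move=> v w [Zv hv] [Zw hw]; split; [exact: (gsubD gZ) | exact: homog_rowD].
- move=> x v [Zv hv]; split; first exact: (gsubZ gZ).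
  apply: homog_row_scale hv; apply/homog_diffP => m; rewrite mcoeffC.
  by case: (eqVneq m 0%MM) => [->|]; rewrite ?mdeg0 // mulr0 eqxx.
- move=> v [_ hv] vcs; apply/rowP=> k; rewrite mxE; apply/mpolyP=> m; rewrite mcoeff0.
  apply/eqP; apply/negP=> /negP vm; have /homog_diffP /(_ m vm) E := hv k.
  have lt : (mdeg m < J.+1)%N by rewrite ltnS -E leq_addr.
  move/eqP: vm; apply; apply: (vcs (k, m)).
  by apply/allpairsP; exists (k, BMultinom lt); rewrite !mem_enum.
exists (l ++ [seq (J, x) | x <- l']); split.
  move=> x; rewrite mem_cat => /orP[/lZ //|/mapP [y yl' ->] /=]; exact: l'Q.
move=> j v; rewrite ltnS leq_eqVlt => /orP[/eqP-> Zv hv|jJ Zv hv]; rewrite map_cat.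
  by apply: span_catr; rewrite -map_comp map_id; apply: l'span.
by apply: span_catl; apply: lspan hv.
Qed.

(** Where the Koszul homology in homological degree 0 vanishes no new
    generator is needed; this takes the place of the noetherian property. *)
Lemma finitely_generated J : (forall a, koszul_nz deg Z (@is0 _ _ _) 0 a -> (a <= J)%N) ->
  exists l : seq (nat * 'rV[S]_r),
    (forall x, x \in l -> Z x.2 /\ homog_row deg x.1 x.2) /\
    forall v, Z v -> span [seq x.2 | x <- l] v.
Proof.
move=> HJ; have [l [lZ lspan]] := generators_upto J.+1; exists l; split=> //.
have hspan j v : Z v -> homog_row deg j v -> span [seq x.2 | x <- l] v.
  elim: j v => [|j IH] v Zv hv; first exact: lspan hv.
  have [jJ|Jj] := leqP j.+1 J; first exact: lspan hv.
  have [b [b1 b2]] : exists b : {set 'I_n} -> 'rV[S]_r,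
      (forall A : {set 'I_n}, #|A| = 1%N -> Z (b A)) /\ kos b set0 = v.
    apply: NNPP => no; have : koszul_nz deg Z (@is0 _ _ _) 0 j.+1.
      exists (fun=> v); split=> // -[b [b1 b2]]; apply: no; exists b; split=> //.
      by apply/eqP; rewrite -subr_eq0; apply/eqP/b2; rewrite cards0.
    by move=> /HJ; rewrite leqNgt Jj.
  have := gproj_id j.+1 hv; rewrite eqxx -b2 kos_gproj => <-.
  apply: span_sum => i _; apply: spanZ; apply: IH; last exact: gproj_hom.
  by apply: (gsub_proj gZ); apply: b1; rewrite setU0 cards1.
move=> v Zv; have [N ->] := gproj_sum deg v; apply: span_sum => a _.
by apply: (hspan a); [exact: (gsub_proj gZ) | exact: gproj_hom].
Qed.

Definition presents r' (deg' : 'I_r' -> nat) (phi : 'M[S]_(r', r)) :=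
  [/\ forall k l, homog_diff (deg' k) (deg l) (phi k l),
      forall w, Z (w *m phi) & forall v, Z v -> exists w, v = w *m phi].

Lemma finite_presents J : (forall a, koszul_nz deg Z (@is0 _ _ _) 0 a -> (a <= J)%N) ->
  exists r' (deg' : 'I_r' -> nat) (phi : 'M[S]_(r', r)), presents deg' phi.
Proof.
move=> /finitely_generated [l [lZ lspan]].
pose l2 := [seq x.2 | x <- l].
have sz : size l2 = size l by rewrite size_map.
exists (size l2), (fun i => (nth (0%N, 0) l i).1), (\matrix_i nth 0 l2 i).
have nthP (i : 'I_(size l2)) : Z (nth 0 l2 i) /\ homog_row deg (nth (0%N, 0) l i).1 (nth 0 l2 i).
  have il : (i < size l)%N by rewrite -sz.
  by rewrite (nth_map (0%N, 0)) //; apply: lZ; apply: mem_nth.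
split=> [k j|w|v /lspan /span_mx //].
  by rewrite mxE; apply: (nthP k).2.
rewrite mulmx_sum_row; apply: (gsub_sum gZ) => i _; apply: (gsubZ gZ).
by rewrite rowK; apply: (nthP i).1.
Qed.

(** If the number of generators is least possible, no relation has an
    invertible coefficient: its component in the degree of the corresponding
    generator would express this generator by the others. *)
Lemma minimal_presents J : (forall a, koszul_nz deg Z (@is0 _ _ _) 0 a -> (a <= J)%N) ->
  exists r' (deg' : 'I_r' -> nat) (phi : 'M[S]_(r', r)), presents deg' phi /\
    forall w : 'rV[S]_r', w *m phi = 0 -> forall k, (w 0 k)@_0%MM = 0.
Proof.
move=> /finite_presents /(@ex_least (fun r' => exists deg' phi, @presents r' deg' phi)).
case=> [[|s]] [[deg' [phi [ph1 ph2 ph3]]] rmin]; exists _, deg', phi; split=> // w w0 k0.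
  by case: k0.
apply/eqP; apply/negP=> /negP c0.
(* Homogeneous, so that its coefficient at [k0] is a nonzero constant. *)
pose w' := gproj deg' (deg' k0) w.
have w'0 : w' *m phi = 0 by rewrite -(gproj_mul _ _ ph1) w0 gproj0.
pose c := (w 0 k0)@_0%MM.
have w'k0 : w' 0 k0 = c%:MP.
  rewrite mxE; apply/mpolyP=> m; rewrite mcoeff_gpart mcoeffC.
  rewrite -[X in _ == X]add0n eqn_add2r mdeg_eq0.
  by case: (eqVneq m 0%MM) => [->|]; rewrite ?mulr1 ?mulr0.
apply: (rmin s (ltnSn s)).
exists (fun i => deg' (lift k0 i)), (row' k0 phi); split.
- by move=> k l; rewrite mxE; apply: ph1.
- move=> u; rewrite mulmx_sum_row; apply: (gsub_sum gZ) => i _; apply: (gsubZ gZ).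
  suff -> : row i (row' k0 phi) = delta_mx 0 (lift k0 i) *m phi by apply: ph2.
  by rewrite -rowE; apply/rowP=> j; rewrite !mxE.
move=> v /ph3 [u ->]; pose u' := u - (u 0 k0 * (c^-1)%:MP) *: w'.
have u'k0 : u' 0 k0 = 0.
  by rewrite mxE [X in _ + X]mxE [X in - X]mxE w'k0 -mulrA -mpolyCM mulVf // mulr1 subrr.
exists (\row_i u' 0 (lift k0 i)).
have -> : u *m phi = u' *m phi by rewrite mulmxBl -scalemxAl w'0 scaler0 subr0.
rewrite !mulmx_sum_row (bigD1_ord k0) //= u'k0 scale0r add0r.
apply: eq_bigr => i _; rewrite mxE; congr (_ *: _).
by apply/rowP=> j; rewrite !mxE.
Qed.
End Generators.

Section Existence.
Variables (K : fieldType) (n J : nat).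
Local Notation S := {mpoly K[n]}.

(** A syzygy module met while building a resolution. The bound on the
    internal degrees of its Koszul homology makes it finitely generated, and
    is inherited by the next syzygy module because dimension shifting
    preserves internal degrees. *)
Record stage := Stage {
  st_r : nat;
  st_deg : 'I_st_r -> nat;
  st_Z : 'rV[S]_st_r -> Prop;
  st_gsub : gsub st_deg st_Z;
  st_min : forall v, st_Z v -> forall k, (v 0 k)@_0%MM = 0;
  st_bound : forall d a, koszul_nz st_deg st_Z (@is0 _ _ _) d a -> (d + a <= J)%N
}.

Record step (s : stage) := Step {
  next : stage;
  st_phi : 'M[S]_(st_r next, st_r s);
  st_homog : forall k l, homog_diff (st_deg k) (st_deg l) (st_phi k l);
  st_exact : forall v, st_Z v <-> exists w, v = w *m st_phi;
  st_next : forall w, st_Z w <-> w *m st_phi = 0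
}.

Lemma step_exists s : inhabited (step s).
Proof.
case: s => r deg Z gZ Zmin Zb.
have [|r' [deg' [phi [[ph1 ph2 ph3] pmin]]]] := @minimal_presents K n r deg Z gZ J.
  by move=> a /Zb.
have surj z : Z z -> exists v, is0 (z - v *m phi).
  by move=> /ph3 [w ->]; exists w; rewrite /is0 subrr.
have g0 := gsub_is0 K n deg.
have rb d a : koszul_nz deg' (relations (@is0 _ _ _) phi) (@is0 _ _ _) d a -> (d + a <= J)%N.
  case: a => [|a]; first by move=> /(koszul_relations0 g0 ph1 pmin).
  by move=> /(koszul_unshift g0 ph1 ph2 surj pmin) /Zb; rewrite addnS.
constructor.
apply: (@Step (Stage gZ Zmin Zb) (Stage (gsub_relations g0 ph1) pmin rb) phi ph1).
  by move=> v /=; split=> [/ph3|[w ->]].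
by move=> w.
Qed.

Definition chosen_step s : step s := epsilon (step_exists s) (fun=> True).

Variable I : S -> Prop.
Hypothesis gI : gsub deg0 (ideal_row I).
Hypothesis I_proper : forall f, I f -> f@_0%MM = 0.
Hypothesis tor_bound : forall d a, tor_nz I d a -> (d + a <= J)%N.

Lemma aug1_homog (k l : 'I_1) : homog_diff (deg0 k) (deg0 l) ((1%:M : 'M[S]_1) k l).
Proof.
rewrite !ord1 mxE; apply/homog_diffP => m; rewrite mcoeff1.
by case: (eqVneq m 0%MM) => [->|]; rewrite ?mdeg0 ?eqxx.
Qed.

Lemma stage0_exists : exists s : stage, exists phi : 'M[S]_(st_r s, 1),
  [/\ forall k, homog_diff (st_deg k) 0 (phi k 0),
      forall f, exists v : 'rV[S]_(st_r s), I (f - (v *m phi) 0 0) &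
      forall v : 'rV[S]_(st_r s), st_Z v <-> I ((v *m phi) 0 0)].
Proof.
have Zmin (v : 'rV[S]_1) : relations (ideal_row I) 1%:M v -> forall k, (v 0 k)@_0%MM = 0.
  by rewrite /relations /ideal_row mulmx1 => /I_proper v0 k; rewrite ord1.
have surj (z : 'rV[S]_1) : True -> exists v, ideal_row I (z - v *m 1%:M).
  by exists z; rewrite mulmx1 subrr; apply: (gsub0 gI).
have bound d a : koszul_nz deg0 (relations (ideal_row I) 1%:M) (@is0 _ _ _) d a -> (d + a <= J)%N.
  case: a => [|a]; first by move=> /(koszul_relations0 gI aug1_homog Zmin).
  move=> /(koszul_unshift gI aug1_homog (fun _ => Logic.I) surj Zmin) /tor_bound.
  by rewrite addnS.
exists (Stage (gsub_relations gI aug1_homog) Zmin bound), 1%:M => /=; split=> //.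
  by move=> k; apply: (aug1_homog k 0).
move=> f; exists (const_mx f); rewrite mulmx1 mxE subrr.
by have := gsub0 gI; rewrite /ideal_row mxE.
Qed.

Lemma min_res_exists : inhabited (min_res I).
Proof.
have [s0 [phi0 [phi0h phi0s phi0e]]] := stage0_exists.
pose fix st i := if i is j.+1 then next (chosen_step (st j)) else s0.
constructor; apply: (@MinRes K n I (fun i => st_r (st i)) (fun i k => st_deg k) phi0
  (fun i => st_phi (chosen_step (st i)))).
- exact: phi0h.
- by move=> i; apply: st_homog.
- exact: phi0s.
- by move=> v; rewrite -phi0e; apply: (@st_exact _ (chosen_step s0)).
- move=> i v; rewrite -(@st_next _ (chosen_step (st i))).
  exact: (@st_exact _ (chosen_step (st i.+1))).
move=> i k l.
have : st_Z (row k (st_phi (chosen_step (st i)))).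
  by apply/st_exact; exists (delta_mx 0 k); rewrite rowE.
by move=> /st_min /(_ l); rewrite mxE.
Qed.
End Existence.

(** * Edge ideals and their regularity *)

Section MonomialIdeal.
Variables (K : fieldType) (n : nat) (D : pred {set 'I_n}).
Hypothesis dD : down_closed D.
Local Notation S := {mpoly K[n]}.
Implicit Types (f g p : S).

Lemma msupportD (m m' : 'X_{1..n}) : msupport (m + m') = msupport m :|: msupport m'.
Proof. by apply/setP=> i; rewrite !inE mnmDE addn_eq0 negb_and. Qed.

Lemma vanish_onD f g : vanish_on D f -> vanish_on D g -> vanish_on D (f + g).
Proof. by move=> hf hg m Dm; rewrite mcoeffD hf // hg // addr0. Qed.

Lemma vanish_onM p f : vanish_on D f -> vanish_on D (p * f).
Proof.
move=> hf m Dm; rewrite mcoeffM big1 // => k /eqP mE.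
by rewrite hf ?mulr0 //; apply: dD Dm; rewrite [X in _ \subset msupport X]mE msupportD subsetUr.
Qed.

Lemma vanish_onX m : ~~ D (msupport m) -> vanish_on D ('X_[m] : S).
Proof. by move=> nD m' Dm'; rewrite mcoeffX; case: eqP => // E; rewrite E Dm' in nD. Qed.

Lemma gsub_vanish_on (I : S -> Prop) : (forall f, I f <-> vanish_on D f) ->
  gsub deg0 (ideal_row I).
Proof.
move=> IE; rewrite /ideal_row; split.
- by rewrite mxE; apply/IE => m _; rewrite mcoeff0.
- by move=> v w /IE hv /IE hw; rewrite mxE; apply/IE; apply: vanish_onD.
- by move=> p v /IE hv; rewrite mxE; apply/IE; apply: vanish_onM.
move=> a v /IE hv; rewrite mxE; apply/IE => m Dm; rewrite mcoeff_gpart hv //.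
by rewrite if_same.
Qed.

Lemma koszul_nz_ext r (deg : 'I_r -> nat) Z (N N' : 'rV[S]_r -> Prop) d a :
  (forall v, N v <-> N' v) -> koszul_nz deg Z N d a -> koszul_nz deg Z N' d a.
Proof.
move=> NN [c [c1 c2 c3]]; exists c; split=> // [B /c2 /NN //|[b [b1 b2]]].
by apply: c3; exists b; split=> // A /b2 /NN.
Qed.
End MonomialIdeal.

Section EdgeIdealReg.
Variables (K : fieldType) (G : sgraph).
Local Notation n := #|G|.
Local Notation S := {mpoly K[n]}.
Local Notation I := (@edge_ideal K G).
Local Notation gens := (@edge_gens K G).

Definition isolated_set : {set G} := [set x | isolated x].
(** An isolated vertex generates the ideal together with the edges, so it is
    not a vertex of the complex. *)
Definition edge_face : pred {set 'I_n} := fun s =>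
  ind_on (~: isolated_set) (enum_val @: s).

Lemma edge_face_down : down_closed edge_face.
Proof. by move=> s t st; apply: ind_on_down; apply: imsetS. Qed.

Lemma edge_ideal_gen (p g : S) : g \in gens -> I (p * g).
Proof.
move=> gin; have ig : (index g gens < size gens)%N by rewrite index_mem.
exists (fun i => if i == Ordinal ig then p else 0).
rewrite (bigD1 (Ordinal ig)) //= eqxx nth_index // big1 ?addr0 // => i /negPf ->.
exact: mul0r.
Qed.

Lemma edge_ideal0 : I 0.
Proof. by exists (fun=> 0); rewrite big1 // => i _; rewrite mul0r. Qed.

Lemma edge_idealD f g : I f -> I g -> I (f + g).
Proof.
move=> [c ->] [c' ->]; exists (fun i => c i + c' i).
by rewrite -big_split; apply: eq_bigr => i _; rewrite mulrDl.
Qed.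

Lemma edge_gens_nonface g : g \in gens ->
  exists2 m : 'X_{1..n}, g = 'X_[m] & ~~ edge_face (msupport m).
Proof.
rewrite mem_cat => /orP[/mapP [[x y] /=]|/mapP [x]].
  rewrite mem_filter /= => /andP[xy _] ->.
  exists (U_(enum_rank x) + U_(enum_rank y))%MM; first by rewrite mpolyXD.
  apply/negP=> /andP[_ /indepP /(_ x y)]; rewrite xy => h; suff : false by []. 
  apply: h; apply/imsetP; [exists (enum_rank x)|exists (enum_rank y)]; rewrite ?enum_rankK //.
    by rewrite inE mnmDE mnm1E eqxx.
  by rewrite inE mnmDE !mnm1E eqxx addn1.
rewrite mem_filter => /andP[xi _] ->; exists (U_(enum_rank x))%MM => //.
apply/negP=> /andP[/subsetP /(_ x) h _]; have : x \in ~: isolated_set.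
  by apply: h; apply/imsetP; exists (enum_rank x); rewrite ?enum_rankK // inE mnm1E eqxx.
by rewrite !inE xi.
Qed.

Lemma nonface_edge_gens (m : 'X_{1..n}) : ~~ edge_face (msupport m) ->
  exists2 m0 : 'X_{1..n}, (m0 <= m)%MM & 'X_[m0] \in gens.
Proof.
rewrite /edge_face /ind_on negb_and => /orP[/subsetPn [x /imsetP [i im ->]]|].
  rewrite inE negbK inE => xi; exists U_(i)%MM; first by move: im; rewrite lep1mP inE.
  rewrite mem_cat; apply/orP; right; apply/mapP; exists (enum_val i).
    by rewrite mem_filter xi mem_enum.
  by rewrite /xvar enum_valK.
rewrite negb_forall => /existsP [x]; rewrite negb_imply => /andP[/imsetP [i im ->]].
rewrite negb_forall => /existsP [y]; rewrite negb_imply => /andP[/imsetP [j jm ->]].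
rewrite negbK => xy; exists (U_(i) + U_(j))%MM.
  apply/mnm_lepP=> k; rewrite mnmDE !mnm1E; rewrite !inE in im jm.
  have ij : i != j by apply: contraTneq xy => ->; rewrite adj_irr.
  case: (eqVneq i k) => [ik|_]; case: (eqVneq j k) => [jk|_] //=.
  - by rewrite ik jk eqxx in ij.
  - by rewrite -ik addn0 lt0n.
  by rewrite -jk add0n lt0n.
rewrite mem_cat; apply/orP; left; apply/mapP; exists (enum_val i, enum_val j).
  by rewrite mem_filter /= xy mem_enum.
by rewrite /xvar !enum_valK mpolyXD.
Qed.

Lemma edge_idealE f : I f <-> vanish_on edge_face f.
Proof.
split=> [[c ->]|hf].
  elim/big_rec: _ => [m _|i p _]; first by rewrite mcoeff0.
  have [|m gE nm] := @edge_gens_nonface gens`_i; first exact: mem_nth.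
  by apply: vanish_onD; rewrite gE; apply: (vanish_onM edge_face_down); apply: vanish_onX.
rewrite (mpolyE f) big_seq; elim/big_rec: _ => [|m p mf]; first exact: edge_ideal0.
apply: edge_idealD; have /nonface_edge_gens [m0 m0m gin] : ~~ edge_face (msupport m).
  by apply/negP=> /hf; apply/eqP; rewrite -mcoeff_msupp.
by rewrite -(submK m0m) mpolyXD scalerAl; apply: edge_ideal_gen.
Qed.

Lemma tor_edge_ideal d a : tor_nz I d a <->
  exists2 W : {set G}, #|W| = (d + a)%N & ind_nz K (W :\: isolated_set) a.
Proof.
pose f : 'I_n -> G := enum_val; have f_inj : injective f := enum_val_inj.
have fK (W : {set G}) : f @: (f @^-1: W) = W.
  apply/setP=> x; apply/imsetP/idP => [[i + ->]|xW]; first by rewrite inE.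
  by exists (enum_rank x); rewrite ?inE /f enum_rankK.
have tr (W : {set 'I_n}) :
    cohom_nz (@order_sgn K 'I_n) (fun s : {set 'I_n} => (s \subset W) && edge_face s) a
    <-> ind_nz K ((f @: W) :\: isolated_set) a.
  have DE (s : {set 'I_n}) : ind_on ((f @: W) :\: isolated_set) (f @: s)
      = (s \subset W) && edge_face s.
    rewrite /edge_face /ind_on andbA; congr (_ && _).
    rewrite setDE subsetI; congr (_ && _).
    by apply/subsetP/subsetP => h x; [rewrite -!(mem_imset _ _ f_inj); apply: h
      | case/imsetP=> i si ->; rewrite mem_imset ?h].
  have Dim t : ind_on ((f @: W) :\: isolated_set) t -> exists s : {set 'I_n}, t = f @: s.
    by move=> _; exists (f @^-1: t).
  have [to from] := cohom_nz_imset f_inj (@order_sgn K G) a DE Dim.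
  have sf := signs_imset f_inj DE (@order_sgn_signs K G _).
  have dW : down_closed (fun s : {set 'I_n} => (s \subset W) && edge_face s).
    by move=> s t st /andP[tW Dt]; rewrite (subset_trans st tW) (edge_face_down st Dt).
  split=> [h|/to h]; first apply: from.
    by apply: cohom_nz_sign h; [exact: dW | exact: order_sgn_signs | exact: sf].
  by apply: cohom_nz_sign h; [exact: dW | exact: sf | exact: order_sgn_signs].
have IE (v : 'rV[S]_1) : ideal_row I v <-> vanish_on edge_face (v 0 0) by apply: edge_idealE.
split=> [/(koszul_nz_ext IE) /(hochster _ _ _ edge_face_down) [W Wd /tr h]|[W Wd h]].
  by exists (f @: W); rewrite ?card_imset.
have IE' v := iff_sym (IE v).
apply: (koszul_nz_ext IE'); apply/(hochster _ _ _ edge_face_down); exists (f @^-1: W).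
  by rewrite -Wd -[in RHS](fK W) card_imset.
by apply/tr; rewrite fK.
Qed.

Lemma edge_min_res_exists : inhabited (min_res I).
Proof.
apply: (@min_res_exists K n n I (gsub_vanish_on edge_face_down edge_idealE)).
  move=> f /edge_idealE; apply; rewrite (_ : msupport _ = set0).
    rewrite /edge_face imset0 /ind_on sub0set; apply/indepP => x y.
    by rewrite inE.
  by apply/setP=> i; rewrite !inE mnm0E.
by move=> d a /tor_edge_ideal [W <- _]; apply: max_card.
Qed.

(** [betti] may use a different resolution for each pair [(i, j)], but
    whether a Betti number vanishes is the same for all of them. *)
Lemma betti_edge_ideal i j : betti I i j <> 0%N <-> exists2 a, j = (a + i)%N & tor_nz I i a.
Proof.
have [F0] := edge_min_res_exists.
have ex : exists b, exists F : min_res I, b = res_betti F i j by exists (res_betti F0 i j), F0.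
have [F bE] := epsilon_spec (inhabits 0%N) _ ex.
rewrite /betti bE; apply: res_betti_neq0.
exact: (gsub_vanish_on edge_face_down edge_idealE).
Qed.

(** Sets that contain isolated vertices do not change the maximum: their
    independence complexes are cones. *)
Lemma reg_edge_ideal r : ind_reg K G r -> reg I = r%:Z.
Proof.
move=> [[W nz] bound].
have isr : is_reg I r%:Z.
  split.
    have Wr := ind_nz_size nz; exists (#|W| - r)%N, #|W|; split; last first.
      by rewrite -subzn // opprB addrC subrK.
    apply/betti_edge_ideal; exists r; first by rewrite addnC subnK.
    apply/tor_edge_ideal; exists W; first by rewrite subnK.
    rewrite (_ : W :\: _ = W) //; apply/setDidPl; rewrite -setI_eq0.
    apply/set0Pn => -[x]; rewrite !inE => /andP[xW /forallP xi].
    by apply: (ind_nz_cone xW _ nz) => y _.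
  move=> i j /betti_edge_ideal [a -> /tor_edge_ideal [W' _ /bound ar]].
  by rewrite PoszD addrK lez_nat.
have ex : exists s, is_reg I s by exists r%:Z.
have [[i [j [bij sE]]] sb] := epsilon_spec (inhabits 0) _ ex.
rewrite -/(reg I) in sE sb *.
case: isr => [[i' [j' [bij' rE]]] rb]; apply/eqP; rewrite eq_le; apply/andP; split.
  by rewrite sE; apply: rb.
by rewrite [X in X <= _]rE; apply: sb.
Qed.
End EdgeIdealReg.

Theorem theorem2p36 (K : fieldType) (u v : nat) (hu : (0 < u)%N) (hv : (0 < v)%N)
    (H : sgraph) (hH : (0 < #|H|)%N) :
  reg (@edge_ideal K (corona (biclique u v) H)) =
    if null_graph H then (maxn u v)%:Z
    else (u + v)%:Z * reg (@edge_ideal K H).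
Proof.
have [r rH] := ind_reg_exists K H.
rewrite (reg_edge_ideal (ind_reg_biclique_corona u v hH rH)) (reg_edge_ideal rH).
by case: ifP => // _; rewrite PoszM.
Qed.
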